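(* Let the array $\mathcal A$ be a disk of radius $a$, and consider a single point-like scatterer at $\vec y_*=(y_*,L+\eta_* )$ with symmetric polarizability tensor $\boldsymbol\alpha_*\in\mathbb C^{3\times3}$, independent of frequency, $\|\boldsymbol\alpha_*\|=\mathcal O(1)$. Assume the Fraunhofer regime holds uniformly over the frequency band $[\omega_0-B/2,\omega_0+B/2]$. Then the multi-frequency active Kirchhoff imaging function satisfies, for all $\vec y=(y_*,L+\eta)$ with $\eta\ne\eta_*$, $$\|\mathbb I_{\mathrm{KM}}(\vec y)\|=B\,\frac{a^4}{L^4}\left[\mathcal O\Big(\frac{c}{B\,|\eta-\eta_*|}\Big)+o(1)\right],$$ and at the scatterer location $$\mathbb I_{\mathrm{KM}}(\vec y_* )=B\left[\frac{a^4}{(16\pi)^2L^4}\begin{pmatrix}\boldsymbol\alpha_{*;1:2,1:2}&\boldsymbol 0\\ \boldsymbol 0&0\end{pmatrix}+o\Big(\frac{a^4}{L^4}\Big)\right],$$ where $\boldsymbol\alpha_{*;1:2,1:2}$ is the leading $2\times2$ principal block of $\boldsymbol\alpha_*$.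
   Context: Notation. Points of $\mathbb R^3$ are written $\vec x=(x,z)$ with $x\in\mathbb R^2$ the cross-range part and $z$ the range part; $c>0$ is the wave speed, $\omega>0$ the angular frequency, $k=\omega/c$. With $\vec r=\vec x-\vec y$, $r=\|\vec r\|$, $m(kr)=(\mathrm i kr-1)/(kr)^2$, and $G(\vec x,\vec y;k)=\frac{e^{\mathrm i k\|\vec x-\vec y\|}}{4\pi\|\vec x-\vec y\|}$, the dyadic Green function is the $3\times3$ matrix $$\mathbb G(\vec x,\vec y;k)=G(\vec x,\vec y;k)\Big[(1+m(kr))\mathbb I-(1+3m(kr))\frac{\vec r\,\vec r^{\top}}{r^2}\Big].$$ Array, data, image. $\mathcal A=\{x_r\in\mathbb R^2:\|x_r\|\le a\}$ is an array of collocated receivers $\vec x_r=(x_r,0)$ and sources $\vec x_s=(x_s,0)$, $x_r,x_s\in\mathcal A$. The data are the array response function (Born approximation) $\Pi(x_r,x_s;k)=\mathbb G(\vec x_r,\vec y_*;k)\,\boldsymbol\alpha_*\,\mathbb G(\vec y_*,\vec x_s;k)$; the single-frequency active Kirchhoff imaging function is $$\mathbb I_{\mathrm{KM}}(\vec y;k)=\int_{\mathcal A}\int_{\mathcal A}\overline{\mathbb G(\vec x_r,\vec y;k)}\,\Pi(x_r,x_s;k)\,\overline{\mathbb G(\vec x_s,\vec y;k)}\,\mathrm dx_r\,\mathrm dx_s\in\mathbb C^{3\times3},$$ and the multi-frequency one, over the band with central frequency $\omega_0$ and bandwidth $B$, is $\mathbb I_{\mathrm{KM}}(\vec y)=\int_{|\omega-\omega_0|<B/2}\mathbb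 I_{\mathrm{KM}}(\vec y;\omega/c)\,\mathrm d\omega$. Fraunhofer regime. Imaging points and the scatterer position lie in the imaging window: they are of the form $(y,L+\eta)$ with $\|y\|=\mathcal O(b)$ and $|\eta|=\mathcal O(h)$. Put $\Theta_a=ka^2/L$, $\Theta_b=kb^2/L$, $\Theta_h=kh^2/L$. The parameters vary so that $kL\gg1$, $a\ll L$, $b\ll L$, $h\ll L$, $\Theta_b\ll1$, $1\ll\Theta_a\ll L^2/a^2$ and $kh=\mathcal O(1)$, where $X\ll Y$ means $X/Y\to0$, all of this uniformly for $k=\omega/c$ with $\omega\in[\omega_0-B/2,\omega_0+B/2]$. The symbols $\mathcal O$, $o$ refer to this limit, uniformly over points of the imaging window. *)

(* Defs.v *)
From HB Require Import structures.
From mathcomp Require Import all_boot all_order all_algebra.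
From mathcomp Require Import complex.
From mathcomp Require Import all_classical all_reals all_analysis.
Set Implicit Arguments.
Unset Strict Implicit.
Unset Printing Implicit Defensive.
Import Order.TTheory GRing.Theory Num.Theory.
Import numFieldNormedType.Exports.
Local Open Scope classical_set_scope.
Local Open Scope ring_scope.

Section Uniformity.
Context {T P : Type}.

(* The filter of properties of (t, q) that hold eventually in t, uniformly over
   all q in W t; a Landau symbol along it is uniform over W. *)
Definition uniform_system (F : set_system T) (W : T -> set P) :
    set_system (T * P) :=
  [set E | \forall t \near F, forall q, W t q -> E (t, q)].

Lemma uniform_system_filter (F : set_system T) (W : T -> set P) :
  Filter F -> Filter (uniform_system F W).
Proof.
move=> FF; split.
- by apply: (@filterE T F) => t q _.
- move=> A B FA FB; apply: (@filterS T F) (@filterI T F _ _ _ FA FB).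
  by move=> t [tA tB] q Wq; split; [exact: tA | exact: tB].
- by move=> A B AB; apply: (@filterS T F) => t tA q Wq; exact: AB (tA q Wq).
Qed.

Definition uniformly (F : filter_on T) (W : T -> set P) : filter_on (T * P) :=
  FilterType (uniform_system F W) (uniform_system_filter W (filter_class F)).

End Uniformity.

Section Asymptotics.
Context {R : realType} {T : Type}.

Definition much_less (F : set_system T) (X Y : T -> R) : Prop :=
  X t / Y t @[t --> F] --> (0 : R).

End Asymptotics.

Section ComplexIntegration.
Context {d : measure_display} {S : measurableType d} {R : realType}.
Variables (mu : {measure set S -> \bar R}) (D : set S).

Definition Cintegral (f : S -> R[i]) : R[i] :=
  Complex (\int[mu]_(x in D) complex.Re (f x))
          (\int[mu]_(x in D) complex.Im (f x)).

Definition mxintegral m n (f : S -> 'M[R[i]]_(m, n)) : 'M[R[i]]_(m, n) :=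
  \matrix_(i, j) Cintegral (fun x => f x i j).

End ComplexIntegration.

Section Norms.
Context {R : realType}.

Definition enorm2 (x : R * R) : R := Num.sqrt (x.1 ^+ 2 + x.2 ^+ 2).

Definition enorm3 (v : 'cV[R]_3) : R := Num.sqrt (\sum_i v i 0 ^+ 2).

(* Frobenius norm; `ComplexField.normc` is the modulus as an element of R. *)
Definition mxnormF m n (A : 'M[R[i]]_(m, n)) : R :=
  Num.sqrt (\sum_i \sum_j ComplexField.Normc.normc (A i j) ^+ 2).

End Norms.

Section Imaging.
Context {R : realType}.

(* The point (x, z) of R^3 with cross-range x and range z. *)
Definition pt3 (x : R * R) (z : R) : 'cV[R]_3 :=
  \col_i [:: x.1; x.2; z]`_i.

Definition expi (t : R) : R[i] := Complex (cos t) (sin t).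

Definition mfactor (s : R) : R[i] := Complex (- 1) s / (s%:C%C) ^+ 2.

Definition green (x y : 'cV[R]_3) (k : R) : R[i] :=
  let r := enorm3 (x - y) in expi (k * r) / (4 * pi * r)%:C%C.

Definition dyadic_green (x y : 'cV[R]_3) (k : R) : 'M[R[i]]_3 :=
  let rv := x - y in
  let r := enorm3 rv in
  let m := mfactor (k * r) in
  green x y k *:
    ((1 + m) *: 1%:M
     - (1 + 3 * m) *: map_mx (real_complex R) (r ^- 2 *: (rv *m rv^T))).

Definition conj_mx m n (A : 'M[R[i]]_(m, n)) : 'M[R[i]]_(m, n) :=
  map_mx (@conjc R) A.

Definition array_disk (a : R) : set (measurableTypeR R * measurableTypeR R) :=
  [set x | enorm2 x <= a].

Definition lebesgue2 := (@lebesgue_measure R \x @lebesgue_measure R)%E.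

Definition array_response (ystar : 'cV[R]_3) (alpha : 'M[R[i]]_3)
    (xr xs : R * R) (k : R) : 'M[R[i]]_3 :=
  dyadic_green (pt3 xr 0) ystar k *m alpha *m
  dyadic_green ystar (pt3 xs 0) k.

Definition kirchhoff_single (a : R) (ystar : 'cV[R]_3) (alpha : 'M[R[i]]_3)
    (y : 'cV[R]_3) (k : R) : 'M[R[i]]_3 :=
  mxintegral lebesgue2 (array_disk a) (fun xs =>
    mxintegral lebesgue2 (array_disk a) (fun xr =>
      conj_mx (dyadic_green (pt3 xr 0) y k) *m
      array_response ystar alpha xr xs k *m
      conj_mx (dyadic_green (pt3 xs 0) y k))).

Definition kirchhoff (a c omega0 B : R) (ystar : 'cV[R]_3)
    (alpha : 'M[R[i]]_3) (y : 'cV[R]_3) : 'M[R[i]]_3 :=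
  mxintegral (@lebesgue_measure R) [set w | `|w - omega0| < B / 2]
    (fun w => kirchhoff_single a ystar alpha y (w / c)).

Definition leading_block (A : 'M[R[i]]_3) : 'M[R[i]]_3 :=
  block_mx (ulsubmx (A : 'M[R[i]]_(2 + 1))) 0 0 (0 : 'M[R[i]]_1).

End Imaging.

Section Regime.

Record imaging_params (R : realType) := MkParams {
  wave_speed : R;
  central_freq : R;
  bandwidth : R;
  array_radius : R;    (* a: radius of the array *)
  standoff : R;     (* L: distance from the array to the imaging window *)
  cross_win : R; (* b: cross-range size of the imaging window *)
  range_win : R  (* h: range size of the imaging window *)
}.

Context {R : realType}.

(* The last clause says that all frequencies of the closed band are positive. *)
Definition admissible (p : imaging_params R) : Prop :=
  [/\ 0 < wave_speed p, 0 < bandwidth p, 0 < array_radius p, 0 < standoff p &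
      [/\ 0 < cross_win p, 0 < range_win p & bandwidth p / 2 < central_freq p]].

Definition band (p : imaging_params R) : set R :=
  [set w | central_freq p - bandwidth p / 2 <= w
           <= central_freq p + bandwidth p / 2].

(* (x, eta) stands for the point (x, L + eta). *)
Definition window (K : R) (p : imaging_params R) : set ((R * R) * R) :=
  [set q | enorm2 q.1 <= K * cross_win p /\ `|q.2| <= K * range_win p].

Definition fraunhofer {T : Type} (F : filter_on T) (p : T -> imaging_params R) :
    Prop :=
  let G := uniformly F (fun t => band (p t)) in
  let k := fun z : T * R => z.2 / wave_speed (p z.1) in
  let a := fun z : T * R => array_radius (p z.1) in
  let L := fun z : T * R => standoff (p z.1) in
  let b := fun z : T * R => cross_win (p z.1) in
  let h := fun z : T * R => range_win (p z.1) in
  let Theta_a := fun z => k z * a z ^+ 2 / L z in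
  let Theta_b := fun z => k z * b z ^+ 2 / L z in
  let one := fun=> 1 in
  [/\ much_less G one (fun z => k z * L z),
      [/\ much_less G a L, much_less G b L & much_less G h L],
      much_less G Theta_b one,
      much_less G one Theta_a /\
      much_less G Theta_a (fun z => L z ^+ 2 / a z ^+ 2) &
      ((fun z => k z * h z) : _ -> R^o) =O_G (one : _ -> R^o)].

End Regime.

(* Main.v *)
(* The whole integrand splits as [A(xr) alpha A(xs)^T] with
   [A(x) = conj(G(x, y)) G(x, ystar)], so the image at one frequency is
   [H alpha H^T] where [H] is the integral of [A] over the disk.  Uniformly in
   the regime, [G] is [exp(i k r) / (4 pi L)] times the projection onto the
   cross-range plane, and the difference of path lengths is the difference of
   ranges up to a relative error tending to 0; since [k h = O(1)] the phase of
   [A] is then [k (etas - eta) + o(1)], independently of [x].  Hence [H] is the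
   projection times [exp(i k (etas - eta)) a^2 / (16 pi L^2)], up to a small
   relative error.  What remains is the integral over the band of
   [exp(2 i w (etas - eta) / c)], which equals [B] at the scatterer and is
   [O(c / |etas - eta|)] elsewhere. *)

Require Import Defs.
From HB Require Import structures.
From mathcomp Require Import all_boot all_order all_algebra.
From mathcomp Require Import complex.
From mathcomp Require Import all_classical all_reals all_analysis.
From mathcomp Require Import measurable_realfun.
From mathcomp Require Import ring lra.
Set Implicit Arguments.
Unset Strict Implicit.
Unset Printing Implicit Defensive.
Import Order.TTheory GRing.Theory Num.Theory.
Import numFieldNormedType.Exports.
Local Open Scope classical_set_scope.
Local Open Scope ring_scope.
Import ComplexField.

(** * Area of the disk *)

(** The smallness of the error has to survive two integrations, over the disk and over the band. For
    this reason both positions, the frequency and the array point are all placed in the index of a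
    single filter: an ordinary limit along it is already a bound uniform in all of them, and each
    integration then costs only the measure of its domain. The phase of one Green function has no
    limit, even after [k L] is removed: its quadratic part is of order [k a^2 / L], which tends to
    infinity. Only the product of the two Green functions has a controlled phase, because the
    scatterer and the imaging point share their cross-range position; so amplitudes are treated one
    Green function at a time, phases only in the product. The constant [16 pi] is the area [pi a^2]
    multiplied by [(4 pi L)^-2]. *)

Lemma itv_integral_derive (R : realType) (f F : R -> R) (a b : R) : a < b ->
  continuous f -> (forall x : R, is_derive x 1 F (f x)) ->
  (\int[lebesgue_measure]_(x in `[a, b]) (f x)%:E = (F b - F a)%:E)%E.
Proof.
move=> ab cf dF.
have cF : continuous F.
  by move=> x; apply: differentiable_continuous; apply/derivable1_diffP; exact: ex_derive.
rewrite (@continuous_FTC2 _ f F)//.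
- exact: continuous_subspaceT.
- split => [x _||]; first exact: ex_derive.
  + exact/cvg_at_right_filter/cF.
  + exact/cvg_at_left_filter/cF.
- by move=> x _; rewrite derive1E; exact: derive_val.
Qed.

Lemma xsection_disk (R : realType) (a x : R) : 0 < a ->
  lebesgue_measure (xsection (array_disk a) x : set R) =
  ((fun u => EFin (2 * Num.sqrt (a ^+ 2 - u ^+ 2))) \_ `[- a, a]) x.
Proof.
move=> a0.
have sE (u v : R) : (enorm2 (u, v) <= a) = (v ^+ 2 <= a ^+ 2 - u ^+ 2).
  rewrite /enorm2/= lerBrDl -[in RHS]ler_sqrt ?sqr_ge0//.
  by rewrite sqrtr_sqr ger0_norm// ltW.
rewrite patchE; case: ifPn.
  rewrite inE/= in_itv/= -ler_norml => xa.
  have ax0 : 0 <= a ^+ 2 - x ^+ 2.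
    by move: xa; rewrite ler_norml => /andP[]; nra.
  rewrite (_ : xsection _ _ =
     [set` `[- Num.sqrt (a ^+ 2 - x ^+ 2), Num.sqrt (a ^+ 2 - x ^+ 2)]]).
    rewrite lebesgue_measure_itv/= lte_fin.
    case: ifPn => [_|]; first by rewrite -EFinB opprK; congr EFin; lra.
    rewrite -leNgt => h; congr EFin; have := sqrtr_ge0 (a ^+ 2 - x ^+ 2); lra.
  apply/seteqP; split => y /=.
    rewrite /xsection/= inE/= /array_disk/= sE in_itv/= -ler_norml => h.
    by rewrite -sqrtr_sqr ler_wsqrtr.
  rewrite /xsection/= inE/= /array_disk/= sE in_itv/= -ler_norml => h.
  rewrite -(sqr_sqrtr ax0) -(real_normK (num_real y)).
  by rewrite ler_sqr ?nnegrE ?sqrtr_ge0.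
rewrite notin_setE/= in_itv/= -ler_norml => /negP; rewrite -ltNge => xa.
rewrite (_ : xsection _ _ = set0) ?measure0//.
apply/seteqP; split => y //=.
rewrite /xsection/= inE/= /array_disk/= sE => h.
have : a ^+ 2 < x ^+ 2.
  by rewrite -(real_normK (num_real x)) ltr_sqr ?nnegrE ?normr_ge0// ltW.
have := sqr_ge0 y; lra.
Qed.

(** The slice lengths are integrated by the substitution [u = a sin t], which keeps everything
    smooth up to the endpoints, where the square root is not differentiable. The integrand becomes
    [2 a^2 cos^2 t], with primitive [a^2 (t + sin t cos t)]. *)
Lemma lebesgue2_disk (R : realType) (a : R) : 0 < a ->
  lebesgue2 (array_disk a) = (pi * a ^+ 2)%:E.
Proof.
move=> a0; rewrite /lebesgue2 /product_measure1/=.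
under eq_integral do rewrite xsection_disk//.
rewrite -integral_mkcond.
pose F (t : R) := a * sin t.
have dF (t : R) : is_derive t 1 F (a * cos t).
  by rewrite /F; apply: is_derive_eq.
have F'E : F^`()%classic = (fun t => a * cos t).
  by apply/funext => t; rewrite derive1E; exact: derive_val.
have cF : continuous F.
  by move=> x; apply: differentiable_continuous; apply/derivable1_diffP; exact: ex_derive.
have cF' : continuous (fun t : R => a * cos t).
  by move=> x; apply: cvgM; [exact: cvg_cst|exact: continuous_cos].
have FN : F (- (pi / 2)) = - a by rewrite /F sinN sin_pihalf mulrN1.
have FP : F (pi / 2) = a by rewrite /F sin_pihalf mulr1.
have pi0 := pi_gt0 R.
rewrite -[X in `[X, _]]FN -[X in `[_, X]]FP.
rewrite (@integration_by_substitution_increasing _ F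
  (fun u => 2 * Num.sqrt (a ^+ 2 - u ^+ 2))); first last.
- apply: continuous_subspaceT => x; apply: cvgM; first exact: cvg_cst.
  apply: (@continuous_comp _ _ _ (fun u : R => a ^+ 2 - u ^+ 2) Num.sqrt).
    by apply: cvgB; [exact: cvg_cst|exact: exprn_continuous].
  exact: sqrt_continuous.
- split => [x _||]; first exact: ex_derive.
  + exact/cvg_at_right_filter/cF.
  + exact/cvg_at_left_filter/cF.
- rewrite F'E; apply/cvg_ex; eexists; exact/cvg_at_left_filter/cF'.
- rewrite F'E; apply/cvg_ex; eexists; exact/cvg_at_right_filter/cF'.
- by rewrite F'E => x _; exact: cF'.
- by move=> x y xI yI xy; rewrite /F ltr_pM2l// ltr_sin.
- lra.
rewrite F'E.
transitivity (\int[lebesgue_measure]_(t in `[(- (pi / 2))%R, (pi / 2)%R])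
    (2 * a ^+ 2 * cos t ^+ 2)%:E)%E.
  apply: eq_integral => t; rewrite inE/= in_itv/= => tI; congr EFin.
  change (2 * Num.sqrt (a ^+ 2 - (a * sin t) ^+ 2) * (a * cos t) =
    2 * a ^+ 2 * cos t ^+ 2).
  rewrite exprMn -[X in X - _]mulr1 -mulrBr -cos2sin2 -exprMn sqrtr_sqr.
  by rewrite ger0_norm ?mulr_ge0 ?cos_ge0_pihalf ?(ltW a0)//; ring.
have dG (t : R) : is_derive t 1 (fun t => a ^+ 2 * (t + sin t * cos t))
    (2 * a ^+ 2 * cos t ^+ 2).
  apply: is_derive_eq; rewrite /GRing.scale/=; have := cos2Dsin2 t. nra.
rewrite (itv_integral_derive _ _ dG).
- by congr EFin; rewrite cosN cos_pihalf !mulr0 !addr0; field.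
- lra.
- move=> x; apply: cvgM; first exact: cvg_cst.
  by apply: cvgM; exact: continuous_cos.
Qed.

(** * Complex-valued integrals *)

Section Modulus.
Context {R : rcfType}.
Implicit Types z w : R[i].

Lemma normcE_ReIm z :
  Normc.normc z = Num.sqrt (complex.Re z ^+ 2 + complex.Im z ^+ 2).
Proof. by case: z. Qed.

Lemma normr_Re_le z : `|complex.Re z| <= Normc.normc z.
Proof. by rewrite normcE_ReIm -sqrtr_sqr ler_wsqrtr// lerDl sqr_ge0. Qed.

Lemma normr_Im_le z : `|complex.Im z| <= Normc.normc z.
Proof. by rewrite normcE_ReIm -sqrtr_sqr ler_wsqrtr// lerDr sqr_ge0. Qed.

Lemma normc_ge0 z : 0 <= Normc.normc z.
Proof. by rewrite normcE_ReIm sqrtr_ge0. Qed.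

Lemma normc_le_ReIm z :
  Normc.normc z <= `|complex.Re z| + `|complex.Im z|.
Proof.
rewrite normcE_ReIm -[leRHS]ger0_norm ?addr_ge0// -[leRHS]sqrtr_sqr ler_wsqrtr//.
rewrite -(real_normK (num_real (complex.Re z))).
rewrite -(real_normK (num_real (complex.Im z))).
have := normr_ge0 (complex.Re z); have := normr_ge0 (complex.Im z); nra.
Qed.

Lemma normc_triangle z w :
  Normc.normc (z + w) <= Normc.normc z + Normc.normc w.
Proof. exact: le_normcD. Qed.

Lemma normc_sum_le I (r : seq I) (P : pred I) (F : I -> R[i]) :
  Normc.normc (\sum_(i <- r | P i) F i) <= \sum_(i <- r | P i) Normc.normc (F i).
Proof.
elim/big_ind2 : _ => [|x1 x2 y1 y2 h1 h2|//]; first by rewrite Normc.normc0.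
exact: le_trans (normc_triangle _ _) (lerD _ _).
Qed.

Lemma normc_opp z : Normc.normc (- z) = Normc.normc z.
Proof. exact: normcN. Qed.

Lemma normc_real (x : R) : Normc.normc x%:C%C = `|x|.
Proof. by rewrite normcE_ReIm/= expr0n addr0 sqrtr_sqr. Qed.

Lemma complex_ReM z w : complex.Re (z * w) =
  complex.Re z * complex.Re w - complex.Im z * complex.Im w.
Proof. by case: z; case: w. Qed.

Lemma complex_ImM z w : complex.Im (z * w) =
  complex.Re z * complex.Im w + complex.Im z * complex.Re w.
Proof. by case: z => a b; case: w => c e /=; rewrite addrC. Qed.

End Modulus.

Section ComplexMeasurable.
Context {d : measure_display} {S : measurableType d} {R : realType}.
Implicit Types f g : S -> R[i].

Definition cmeasurable f :=
  measurable_fun setT (fun x => complex.Re (f x)) /\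
  measurable_fun setT (fun x => complex.Im (f x)).

Lemma cmeasurable_cst z : cmeasurable (fun=> z).
Proof. by split; exact: measurable_cst. Qed.

Lemma cmeasurable_Complex (u v : S -> R) : measurable_fun setT u ->
  measurable_fun setT v -> cmeasurable (fun x => Complex (u x) (v x)).
Proof. by []. Qed.

Lemma cmeasurableD f g : cmeasurable f -> cmeasurable g ->
  cmeasurable (fun x => f x + g x).
Proof.
move=> [f1 f2] [g1 g2]; split.
- rewrite (_ : (fun x => complex.Re _) =
    (fun x => complex.Re (f x) + complex.Re (g x))); first exact: measurable_funD.
  by apply/funext => x; rewrite raddfD.
- rewrite (_ : (fun x => complex.Im _) =
    (fun x => complex.Im (f x) + complex.Im (g x))); first exact: measurable_funD.
  by apply/funext => x; rewrite raddfD.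
Qed.

Lemma cmeasurableM f g : cmeasurable f -> cmeasurable g ->
  cmeasurable (fun x => f x * g x).
Proof.
move=> [f1 f2] [g1 g2]; split.
- under eq_fun do rewrite complex_ReM.
  by apply: measurable_funB; exact: measurable_funM.
- under eq_fun do rewrite complex_ImM.
  by apply: measurable_funD; exact: measurable_funM.
Qed.

Lemma cmeasurableN f : cmeasurable f -> cmeasurable (fun x => - f x).
Proof.
move=> mf; under eq_fun do rewrite -mulN1r.
exact: cmeasurableM (cmeasurable_cst _) mf.
Qed.

Lemma cmeasurableB f g : cmeasurable f -> cmeasurable g ->
  cmeasurable (fun x => f x - g x).
Proof. by move=> mf /cmeasurableN mg; exact: cmeasurableD. Qed.

Lemma cmeasurable_conj f : cmeasurable f -> cmeasurable (fun x => (f x)^*%C).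
Proof.
move=> [f1 f2]; split.
- by rewrite (_ : (fun x => _) = (fun x => complex.Re (f x)))//;
    apply/funext => x; case: (f x).
- rewrite (_ : (fun x => _) = (fun x => - complex.Im (f x))).
    exact: measurable_funN.
  by apply/funext => x; case: (f x).
Qed.

Lemma cmeasurable_sum I (r : seq I) (F : I -> S -> R[i]) :
  (forall i, cmeasurable (F i)) -> cmeasurable (fun x => \sum_(i <- r) F i x).
Proof.
move=> mF; elim: r => [|i r IH].
  by under eq_fun do rewrite big_nil; exact: cmeasurable_cst.
by under eq_fun do rewrite big_cons; exact: cmeasurableD.
Qed.

Lemma cmeasurable_real (u : S -> R) : measurable_fun setT u ->
  cmeasurable (fun x => (u x)%:C%C).
Proof. by move=> mu; split => //=; exact: measurable_cst. Qed.

Lemma cmeasurable_expi (u : S -> R) : measurable_fun setT u ->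
  cmeasurable (fun x => expi (u x)).
Proof.
move=> mu; split => /=.
- apply: (measurableT_comp _ mu); apply: continuous_measurable_fun.
  exact: continuous_cos.
- apply: (measurableT_comp _ mu); apply: continuous_measurable_fun.
  exact: continuous_sin.
Qed.

End ComplexMeasurable.

Section ComplexIntegral.
Context {d : measure_display} {S : measurableType d} {R : realType}.
Variables (mu : {measure set S -> \bar R}) (D : set S).
Hypothesis mD : measurable D.
Implicit Types f g : S -> R[i].

Definition cintegrable f :=
  mu.-integrable D (EFin \o (fun x => complex.Re (f x))) /\
  mu.-integrable D (EFin \o (fun x => complex.Im (f x))).

Lemma cintegrable_bounded f (M : R) : (mu D < +oo)%E -> cmeasurable f ->
  (forall x, D x -> Normc.normc (f x) <= M) -> cintegrable f.
Proof.
move=> Dfin [f1 f2] fM; split; apply: measurable_bounded_integrable => //.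
- exact: measurable_funTS.
- exists M; split; first exact: num_real.
  move=> N /ltW MN x Dx /=.
  exact: le_trans (normr_Re_le _) (le_trans (fM _ Dx) MN).
- exact: measurable_funTS.
- exists M; split; first exact: num_real.
  move=> N /ltW MN x Dx /=.
  exact: le_trans (normr_Im_le _) (le_trans (fM _ Dx) MN).
Qed.

Lemma CintegralD f g : cintegrable f -> cintegrable g ->
  Cintegral mu D (fun x => f x + g x) = Cintegral mu D f + Cintegral mu D g.
Proof.
move=> [f1 f2] [g1 g2]; rewrite /Cintegral -[RHS]/(Complex (_ + _) (_ + _)).
rewrite -!RintegralD//; congr Complex; apply: eq_Rintegral => x _;
  by rewrite raddfD.
Qed.

Lemma cintegrableD f g : cintegrable f -> cintegrable g ->
  cintegrable (fun x => f x + g x).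
Proof.
move=> [f1 f2] [g1 g2]; split.
- apply: eq_integrable (integrableD mD f1 g1) => // x _ /=.
  by rewrite raddfD EFinD.
- apply: eq_integrable (integrableD mD f2 g2) => // x _ /=.
  by rewrite raddfD EFinD.
Qed.

Lemma cintegrable_cst0 : cintegrable (fun=> 0).
Proof. by split => /=; exact: integrable0. Qed.

Lemma cintegrableZ (c : R[i]) f : cintegrable f -> cintegrable (fun x => c * f x).
Proof.
move=> [f1 f2]; split.
- have h1 := integrableZl mD (complex.Re c) f1.
  have h2 := integrableZl mD (complex.Im c) f2.
  apply: eq_integrable (integrableB mD h1 h2) => // x _ /=.
  by rewrite complex_ReM EFinB !EFinM.
- have h1 := integrableZl mD (complex.Re c) f2.
  have h2 := integrableZl mD (complex.Im c) f1.
  apply: eq_integrable (integrableD mD h1 h2) => // x _ /=.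
  by rewrite complex_ImM EFinD !EFinM.
Qed.

Lemma CintegralZ (c : R[i]) f : cintegrable f ->
  Cintegral mu D (fun x => c * f x) = c * Cintegral mu D f.
Proof.
move=> [f1 f2]; rewrite /Cintegral.
under eq_Rintegral do rewrite complex_ReM.
under [X in Complex _ X]eq_Rintegral do rewrite complex_ImM.
have Zint r (u : S -> R) : mu.-integrable D (EFin \o u) ->
    mu.-integrable D (EFin \o (fun x => r * u x)).
  by move=> iu; apply: eq_integrable (integrableZl mD r iu).
rewrite RintegralB ?RintegralD//; try exact: Zint.
by rewrite !RintegralZl//; case: (c) => a b /=; simpc; rewrite [X in Complex _ X]addrC.
Qed.

Lemma cintegrable_sum I (r : seq I) (F : I -> S -> R[i]) :
  (forall i, cintegrable (F i)) -> cintegrable (fun x => \sum_(i <- r) F i x).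
Proof.
move=> mF; elim: r => [|i r IH].
  by under eq_fun do rewrite big_nil; exact: cintegrable_cst0.
by under eq_fun do rewrite big_cons; exact: cintegrableD.
Qed.

Lemma Cintegral_sum I (r : seq I) (F : I -> S -> R[i]) :
  (forall i, cintegrable (F i)) ->
  Cintegral mu D (fun x => \sum_(i <- r) F i x) =
  \sum_(i <- r) Cintegral mu D (F i).
Proof.
move=> iF; elim: r => [|i r IH].
  under eq_fun do rewrite big_nil.
  by rewrite big_nil /Cintegral/= Rintegral_cst// mul0r.
under eq_fun do rewrite big_cons.
by rewrite big_cons CintegralD ?IH//; exact: cintegrable_sum.
Qed.

Lemma Cintegral_cst (c : R[i]) :
  Cintegral mu D (fun=> c) = c * (fine (mu D))%:C%C.
Proof.
rewrite /Cintegral !Rintegral_cst//; case: c => a b /=.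
by simpc.
Qed.

(** The factor 2 comes from bounding the real and imaginary parts separately. It is not sharp, but
    it only ever multiplies an arbitrarily small error. *)
Lemma normc_Cintegral_le f (M : R) : (mu D < +oo)%E -> cmeasurable f ->
  (forall x, D x -> Normc.normc (f x) <= M) ->
  Normc.normc (Cintegral mu D f) <= 2 * (M * fine (mu D)).
Proof.
move=> Dfin mf fM; have [i1 i2] := cintegrable_bounded Dfin mf fM.
have bnd (u : S -> R) : mu.-integrable D (EFin \o u) ->
    (forall x, D x -> `|u x| <= M) -> `|\int[mu]_(x in D) u x| <= M * fine (mu D).
  move=> iu uM; rewrite -Rintegral_cst//.
  apply: le_trans (le_normr_Rintegral mD iu) _; apply: le_Rintegral => //.
    exact: integrable_norm.
  apply: measurable_bounded_integrable => //.
  by exists `|M|; split; [exact: num_real|move=> N /ltW MN x Dx].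
apply: le_trans (normc_le_ReIm _) _; rewrite mulr2n mulrDl !mul1r/=.
apply: lerD; apply: bnd => // x Dx.
- exact: le_trans (normr_Re_le _) (fM _ Dx).
- exact: le_trans (normr_Im_le _) (fM _ Dx).
Qed.

Lemma mxintegral_mulmxr m n q (A : S -> 'M[R[i]]_(m, n)) (C : 'M[R[i]]_(n, q)) :
  (forall i j, cintegrable (fun x => A x i j)) ->
  mxintegral mu D (fun x => A x *m C) = mxintegral mu D A *m C.
Proof.
move=> iA; apply/matrixP => i j; rewrite !mxE.
under [X in Cintegral _ _ X]eq_fun => x.
  rewrite mxE; under eq_bigr do rewrite mulrC.
  over.
rewrite Cintegral_sum => [|l]; last exact: cintegrableZ.
by apply: eq_bigr => l _; rewrite CintegralZ// mxE mulrC.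
Qed.

Lemma mxintegral_mulmxl m n q (C : 'M[R[i]]_(m, n)) (A : S -> 'M[R[i]]_(n, q)) :
  (forall i j, cintegrable (fun x => A x i j)) ->
  mxintegral mu D (fun x => C *m A x) = C *m mxintegral mu D A.
Proof.
move=> iA; apply/matrixP => i j; rewrite !mxE.
under [X in Cintegral _ _ X]eq_fun => x do rewrite mxE.
rewrite Cintegral_sum => [|l]; last exact: cintegrableZ.
by apply: eq_bigr => l _; rewrite CintegralZ// mxE.
Qed.

Lemma mxintegral_tr m n (A : S -> 'M[R[i]]_(m, n)) :
  mxintegral mu D (fun x => (A x)^T) = (mxintegral mu D A)^T.
Proof.
by apply/matrixP => i j; rewrite !mxE; under [X in Cintegral _ _ X]eq_fun do rewrite mxE.
Qed.

End ComplexIntegral.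

Section ParametricIntegral.
Context {d1 d2 : measure_display} {S1 : measurableType d1} {S2 : measurableType d2}.
Context {R : realType}.
Variables (mu : {sigma_finite_measure set S2 -> \bar R}) (D : set S2).
Hypothesis mD : measurable D.

(** Splitting into positive and negative parts makes Tonelli's theorem applicable to each, so no
    integrability is assumed; the domain [D] is absorbed by extending the integrand by 0. *)
Lemma measurable_fun_Rintegral (f : S1 * S2 -> R) : measurable_fun setT f ->
  measurable_fun setT (fun w => \int[mu]_(x in D) f (w, x)).
Proof.
move=> mf; rewrite /Rintegral.
apply: (@measurableT_comp _ _ _ _ _ _ fine) => //.
under eq_fun do rewrite integralE.
have part (g : S1 * S2 -> \bar R) : measurable_fun setT g ->
    (forall z, (0 <= g z)%E) ->
    measurable_fun setT (fun w => \int[mu]_(x in D) g (w, x))%E.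
  move=> mg g0.
  rewrite (_ : (fun w => _) = (fun w => \int[mu]_x ((g \_ (setT `*` D)) (w, x)))%E).
    apply: (measurable_fun_fubini_tonelli_F (g \_ (setT `*` D))).
      by apply/(measurable_restrictT _ _).1; [exact: measurableX|exact: measurable_funTS].
    by move=> z; rewrite patchE; case: ifP.
  apply/funext => w; rewrite integral_mkcond; apply: eq_integral => x _.
  rewrite !patchE; congr (if _ then _ else _).
  by apply/idP/idP; rewrite !inE/=; [move=> ?|case].
apply: emeasurable_funB.
- have mp : measurable_fun setT ((EFin \o f)^\+)%E.
    exact/measurable_funepos/measurable_EFinP.
  rewrite [X in measurable_fun _ X](_ : _ =
    (fun w => \int[mu]_(x in D) ((EFin \o f)^\+ (w, x)))%E).
    exact: (part _ mp (funepos_ge0 _)).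
  by apply/funext => w; apply: eq_integral => x _; rewrite !funeposE.

- have mn : measurable_fun setT ((EFin \o f)^\-)%E.
    exact/measurable_funeneg/measurable_EFinP.
  rewrite [X in measurable_fun _ X](_ : _ =
    (fun w => \int[mu]_(x in D) ((EFin \o f)^\- (w, x)))%E).
    exact: (part _ mn (funeneg_ge0 _)).
  by apply/funext => w; apply: eq_integral => x _; rewrite !funenegE.

Qed.

Lemma cmeasurable_Cintegral (f : S1 * S2 -> R[i]) : cmeasurable f ->
  cmeasurable (fun w => Cintegral mu D (fun x => f (w, x))).
Proof.
move=> [f1 f2]; split.
- exact: (@measurable_fun_Rintegral (fun z => complex.Re (f z)) f1).
- exact: (@measurable_fun_Rintegral (fun z => complex.Im (f z)) f2).
Qed.

End ParametricIntegral.

(** * Band integral and measurability of the Green function *)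

Section BandIntegral.
Context {R : realType}.

Lemma band_itv (w0 B : R) :
  [set w : R | `|w - w0| < B / 2] = [set` `]w0 - B / 2, w0 + B / 2[].
Proof.
by apply/seteqP; split => w /=; rewrite in_itv/= ltr_distl.
Qed.

Lemma measurable_band (w0 B : R) :
  measurable ([set w : R | `|w - w0| < B / 2] : set (measurableTypeR R)).
Proof. by rewrite band_itv. Qed.

Lemma lebesgue_band (w0 B : R) : 0 < B ->
  lebesgue_measure [set w : R | `|w - w0| < B / 2] = B%:E.
Proof.
move=> B0; rewrite band_itv lebesgue_measure_itv/= lte_fin ifT; last lra.
by rewrite -EFinB; congr EFin; lra.
Qed.

(** The primitives [sin (s w) / s] and [- cos (s w) / s] are bounded by [1 / |s|], so each component
    integral is at most [2 / |s|], whatever the band. *)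
Lemma normc_Cintegral_expi (s w0 B : R) : s != 0 -> 0 < B ->
  Normc.normc (Cintegral (@lebesgue_measure R)
    [set w | `|w - w0| < B / 2] (fun w => expi (s * w))) <= 4 / `|s|.
Proof.
move=> s0 B0; rewrite band_itv.
have ab : w0 - B / 2 < w0 + B / 2 by lra.
have cs : continuous (fun w : R => s * w) by exact: mulrl_continuous.
have bound (f F : R -> R) : continuous f ->
    (forall x : R, is_derive x 1 F (f x)) -> (forall x, `|F x| <= `|s|^-1) ->
    `|\int[lebesgue_measure]_(w in `]w0 - B / 2, w0 + B / 2[) f w| <= 2 / `|s|.
  move=> cf dF Fs; rewrite /Rintegral.
  have mf D : measurable_fun D (EFin \o f).
    by apply/measurable_EFinP; apply: measurable_funTS; exact: continuous_measurable_fun.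
  rewrite integral_itv_bndo_bndc// integral_itv_obnd_cbnd//.
  rewrite (itv_integral_derive ab cf dF)/=.
  apply: le_trans (ler_normB _ _) _.
  by rewrite mulr2n mulrDl mul1r; exact: lerD.
apply: le_trans (normc_le_ReIm _) _ => /=.
rewrite (_ : 4 / `|s| = 2 / `|s| + 2 / `|s|); last by rewrite -mulrDl; congr (_ / _); lra.
have ds (f : R -> R) (f' x : R) : is_derive (s * x) 1 f f' ->
    is_derive x 1 (fun w => s^-1 * f (s * w)) f'.
  move=> df.
  have dc : is_derive x 1 ( *%R s) s by apply: is_derive_eq; rewrite /GRing.scale/= mulr1.
  have := is_derive1_comp df dc => dfs.
  by apply: is_derive_eq; rewrite /GRing.scale/= mulrCA mulVf// mulr1.
have smalls (u : R) : `|u| <= 1 -> `|s^-1 * u| <= `|s|^-1.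
  by move=> u1; rewrite normrM normfV ler_piMr// invr_ge0.
apply: lerD.
- apply: (bound _ (fun w => s^-1 * sin (s * w))).
  + by move=> x; apply: continuous_comp; [exact: cs|exact: continuous_cos].
  + by move=> x; apply: smalls; exact: sin_max.
- apply: (bound _ (fun w => s^-1 * - cos (s * w))).
  + by move=> x; apply: continuous_comp; [exact: cs|exact: continuous_sin].
  + move=> x.
    have dc : is_derive (s * x) 1 (fun y : R => - cos y) (sin (s * x)).
      by apply: is_derive_eq; rewrite opprK.
    exact: (@ds (fun y => - cos y)).
  + by move=> x; apply: smalls; rewrite normrN; exact: cos_max.
Qed.

End BandIntegral.

Section GreenMeasurable.
Context {R : realType}.

(** Inversion sends 0 to 0 and is discontinuous there, so the line is cut into the open set of
    nonzero reals, where continuity suffices, and a singleton. *)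
Lemma measurable_inv : measurable_fun setT (@GRing.inv R).
Proof.
rewrite -(setvU [set (0 : R)]); apply/measurable_funU => //.
  exact: measurableC.
split; last exact: measurable_fun_set1.
apply: open_continuous_measurable_fun; first by rewrite openC; exact: closed_eq.
by move=> x; rewrite inE/= => /eqP x0; exact: inv_continuous.
Qed.

Context {d : measure_display} {S : measurableType d}.

Lemma measurable_funV (f : S -> R) : measurable_fun setT f ->
  measurable_fun setT (fun x => (f x)^-1).
Proof. by move=> mf; exact: (measurableT_comp measurable_inv mf). Qed.

Lemma measurable_fun_sqrt (f : S -> R) : measurable_fun setT f ->
  measurable_fun setT (fun x => Num.sqrt (f x)).
Proof.
move=> mf; apply: (measurableT_comp _ mf); apply: continuous_measurable_fun.
exact: sqrt_continuous.
Qed.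

(** Every operation building an entry is measurable on its whole domain, inversion included, so the
    singular points where [k r = 0] need not be excluded. *)
Lemma cmeasurable_dyadic_green (u v : S -> 'cV[R]_3) (k : S -> R) i j :
  (forall l, measurable_fun setT (fun s => u s l 0)) ->
  (forall l, measurable_fun setT (fun s => v s l 0)) ->
  measurable_fun setT k ->
  cmeasurable (fun s => dyadic_green (u s) (v s) (k s) i j).
Proof.
move=> mu mv mk.
have mrv l : measurable_fun setT (fun s => (u s - v s) l 0).
  rewrite (_ : (fun s => _) = (fun s => u s l 0 - v s l 0)).
    exact: measurable_funB.
  by apply/funext => s; rewrite !mxE.
have mr : measurable_fun setT (fun s => enorm3 (u s - v s)).
  apply: measurable_fun_sqrt.
  rewrite (_ : (fun s => _) = (fun s => (u s - v s) 0 0 ^+ 2 +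
     ((u s - v s) 1 0 ^+ 2 + (u s - v s) 2%:R 0 ^+ 2))).
    by do !apply: measurable_funD; apply: measurable_funX.
  apply/funext => s; rewrite !big_ord_recl big_ord0 addr0.
  by do !congr (_ + _); congr (_ ^+ 2); congr (fun_of_matrix _ _ _); exact/val_inj.
have mm : cmeasurable (fun s => mfactor (k s * enorm3 (u s - v s))).
  rewrite (_ : (fun s => _) = (fun s => Complex (- 1) (k s * enorm3 (u s - v s)) *
    ((k s * enorm3 (u s - v s)) ^- 2)%:C%C)).
    apply: cmeasurableM.
      apply: cmeasurable_Complex; first exact: measurable_cst.
      exact: measurable_funM.
    apply: cmeasurable_real; apply: measurable_funV; apply: measurable_funX.
    exact: measurable_funM.
  by apply/funext => s; rewrite /mfactor fmorphV rmorphXn.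
under eq_fun do rewrite /dyadic_green/green !mxE.
apply: cmeasurableM; last first.
  apply: cmeasurableB; apply: cmeasurableM.
  - by apply: cmeasurableD => //; exact: cmeasurable_cst.
  - exact: cmeasurable_cst.
  - apply: cmeasurableD; first exact: cmeasurable_cst.
    by apply: cmeasurableM => //; exact: cmeasurable_cst.
  - apply: cmeasurable_real; apply: measurable_funM.
      by apply: measurable_funV; exact: measurable_funX.
    rewrite (_ : (fun s => _) = (fun s => (u s - v s) i 0 * (u s - v s) j 0)).
      exact: measurable_funM.
    by apply/funext => s; rewrite !mxE big_ord1 !mxE.
apply: cmeasurableM; first by apply: cmeasurable_expi; exact: measurable_funM.
rewrite (_ : (fun s => _) = (fun s => ((4 * pi * enorm3 (u s - v s))^-1)%:C%C)).
  apply: cmeasurable_real; apply: measurable_funV; apply: measurable_funM => //.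
by apply/funext => s; rewrite fmorphV.
Qed.

Lemma measurable_pt3 (x : S -> R * R) (z : R) l :
  measurable_fun setT (fun s => (x s).1) -> measurable_fun setT (fun s => (x s).2) ->
  measurable_fun setT (fun s => pt3 (x s) z l 0).
Proof.
move=> m1 m2; under eq_fun do rewrite mxE.
case: l => -[|[|[|//]]] ? /=; [exact: m1|exact: m2|exact: measurable_cst].
Qed.

End GreenMeasurable.

(** * Factorization of the single-frequency image *)

Section Focus.
Context {R : realType}.
Implicit Types x y ystar : 'cV[R]_3.

Lemma enorm3N (v : 'cV[R]_3) : enorm3 (- v) = enorm3 v.
Proof. by congr Num.sqrt; apply: eq_bigr => i _; rewrite mxE sqrrN. Qed.

(** Reciprocity: reversing [rv] changes neither its norm nor [rv rv^T]. Together with the symmetry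
    of the matrix, this turns the source half of the integrand into the transpose of the receiver
    half. *)
Lemma dyadic_greenC x y k : dyadic_green x y k = dyadic_green y x k.
Proof.
rewrite /dyadic_green/green -(opprB y x) enorm3N.
by rewrite linearN/= mulNmx mulmxN opprK.
Qed.

Lemma dyadic_green_tr x y k : (dyadic_green x y k)^T = dyadic_green x y k.
Proof.
rewrite /dyadic_green linearZ/= linearB/= !linearZ/= trmx1 map_trmx linearZ/=.
by rewrite trmx_mul trmxK.
Qed.

Lemma conj_mx_tr m n (A : 'M[R[i]]_(m, n)) : (conj_mx A)^T = conj_mx A^T.
Proof. exact: map_trmx. Qed.

(** The factor [A(x)] of the overview; its integral [focus] is the matrix [H]. *)
Definition pair_field ystar y (k : R) (x : R * R) : 'M[R[i]]_3 :=
  conj_mx (dyadic_green (pt3 x 0) y k) *m dyadic_green (pt3 x 0) ystar k.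

Lemma pair_fieldE ystar y (k : R) (x : R * R) i j :
  pair_field ystar y k x i j =
  \sum_l (dyadic_green (pt3 x 0) y k i l)^*%C * dyadic_green (pt3 x 0) ystar k l j.
Proof. by rewrite mxE; apply: eq_bigr => l _; rewrite [X in X * _]mxE. Qed.

Definition focus (a : R) ystar y (k : R) : 'M[R[i]]_3 :=
  mxintegral lebesgue2 (array_disk a) (pair_field ystar y k).

Lemma measurable_array_disk (a : R) : measurable (array_disk a).
Proof.
rewrite (_ : array_disk a = (@enorm2 R) @^-1` `]-oo, a]); last first.
  by apply/seteqP; split => x /=; rewrite in_itv.
rewrite -[X in measurable X]setTI.
have : measurable_fun [set: measurableTypeR R * measurableTypeR R] (@enorm2 R).
  apply: measurable_fun_sqrt; apply: measurable_funD; apply: measurable_funX.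
  - exact: measurable_fst.
  - exact: measurable_snd.
by apply => //; exact: measurable_itv.
Qed.

Lemma lebesgue2_sigma_finite : sigma_finite setT (@lebesgue2 R).
Proof.
(* The radius is [n.+1] so that it is positive, as the area formula requires, and exceeds any norm
   with integer part [n]. *)
exists (fun n => array_disk n.+1%:R) => [|n].
  apply/esym/seteqP; split => // x _; exists (Num.truncn (enorm2 x)) => //=.
  exact/ltW/truncnS_gt.
split; first exact: measurable_array_disk.
by rewrite lebesgue2_disk ?ltry.
Qed.

(* Inference finds no sigma-finite structure on a product measure: the library
   instance is masked by the one for subprobabilities. *)
Definition lebesgue2_measure :
    {sigma_finite_measure set (measurableTypeR R * measurableTypeR R)%type -> \bar R} :=
  HB.pack_for
    {sigma_finite_measure set (measurableTypeR R * measurableTypeR R)%type -> \bar R}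
    (@lebesgue2 R) (Measure.on (@lebesgue_measure R \x @lebesgue_measure R)%E)
    (Measure_isSigmaFinite.Build _ (measurableTypeR R * measurableTypeR R)%type R
      (@lebesgue2 R) lebesgue2_sigma_finite).

(** For fixed [xs] the integrand is [P(xr) alpha P(xs)^T] with [P] the pair field, so the constant
    right factor leaves the inner integral and the resulting constant left factor leaves the outer
    one. Linearity suffices; no exchange of integrals occurs. *)
Lemma kirchhoff_single_focus a ystar (alpha : 'M[R[i]]_3) y k :
  (forall i j, cintegrable lebesgue2 (array_disk a)
     (fun xr => pair_field ystar y k xr i j)) ->
  kirchhoff_single a ystar alpha y k =
  focus a ystar y k *m alpha *m (focus a ystar y k)^T.
Proof.
move=> iA; rewrite /kirchhoff_single.
have mD := @measurable_array_disk a.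
rewrite -mxintegral_tr.
rewrite -mxintegral_mulmxl//; last by move=> i j; under eq_fun do rewrite mxE.
congr mxintegral; apply/funext => xs.
set P := pair_field ystar y k in iA *.
have E := mxintegral_mulmxr mD (alpha *m (P xs)^T) iA.
rewrite -[RHS]mulmxA; apply: etrans E.
congr mxintegral; apply/funext => xr.
rewrite /array_response /P /pair_field (dyadic_greenC ystar).
move: (dyadic_green_tr (pt3 xs 0) y k) (dyadic_green_tr (pt3 xs 0) ystar k).
move: (dyadic_green (pt3 xr 0) y k) (dyadic_green (pt3 xs 0) y k) => G1 G2.
move: (dyadic_green (pt3 xr 0) ystar k) (dyadic_green (pt3 xs 0) ystar k) => G3 G4.
move=> t2 t4.
rewrite trmx_mul conj_mx_tr t2 t4.
by rewrite !mulmxA.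
Qed.

Lemma cmeasurable_pair_field {d : measure_display} {S : measurableType d}
    (ystar y : 'cV[R]_3) (k : S -> R) (xr : S -> R * R) i j :
  measurable_fun setT k -> measurable_fun setT (fun s => (xr s).1) ->
  measurable_fun setT (fun s => (xr s).2) ->
  cmeasurable (fun s => pair_field ystar y (k s) (xr s) i j).
Proof.
move=> mk mx1 mx2; under eq_fun do rewrite pair_fieldE.
apply: cmeasurable_sum => l; apply: cmeasurableM.
  apply: cmeasurable_conj; apply: cmeasurable_dyadic_green => // n.
  exact: measurable_pt3.
apply: cmeasurable_dyadic_green => // n.
exact: measurable_pt3.
Qed.

(** Joint measurability in frequency and array point passes to the integral over the array point.
    This makes the integral over the band splittable into main term and error. *)
Lemma cmeasurable_focus (a c : R) ystar y i j :
  cmeasurable (fun w : measurableTypeR R => focus a ystar y (w / c) i j).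
Proof.
under eq_fun do rewrite mxE.
have mA : cmeasurable
    (fun z : measurableTypeR R * (measurableTypeR R * measurableTypeR R) =>
     pair_field ystar y (z.1 / c) z.2 i j).
  apply: cmeasurable_pair_field.
  - by apply: measurable_funM; [exact: measurable_fst|exact: measurable_cst].
  - exact: (measurableT_comp measurable_fst measurable_snd).
  - exact: (measurableT_comp measurable_snd measurable_snd).
have := @cmeasurable_Cintegral _ _ (measurableTypeR R)
  (measurableTypeR R * measurableTypeR R)%type R
  lebesgue2_measure _ (measurable_array_disk a) _ mA.
exact.
Qed.

End Focus.

(** * Far-field limits *)

Section Expi.
Context {R : realType}.
Implicit Types s t : R.

Lemma normc_expi t : Normc.normc (expi t) = 1.
Proof. by rewrite normcE_ReIm/= cos2Dsin2 sqrtr1. Qed.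

Lemma expiD s t : expi (s + t) = expi s * expi t :> R[i].
Proof.
by rewrite /expi cosD sinD; apply/eqP; rewrite eq_complex/= eqxx addrC eqxx.
Qed.

Lemma expi_conj t : (expi t)^*%C = expi (- t) :> R[i].
Proof. by rewrite /expi cosN sinN. Qed.

Lemma expi0 : expi 0 = 1 :> R[i].
Proof. by rewrite /expi cos0 sin0. Qed.

End Expi.

Section CrossRangeProjection.
Context {R : realType}.

Definition cross_diag : 'rV[R[i]]_3 := \row_i (i < 2)%N%:R.

(** The limit of [I - rv rv^T / r^2] when the direction of [rv] tends to the range axis. *)
Definition cross_proj : 'M[R[i]]_3 := diag_mx cross_diag.

Lemma cross_projE i j : cross_proj i j = ((i == j) && (i < 2)%N)%:R.
Proof. by rewrite !mxE; case: eqP => [->|_]; rewrite ?mulr1n ?mulr0n. Qed.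

Lemma leading_blockE (A : 'M[R[i]]_3) i j :
  leading_block A i j = (i < 2)%N%:R * A i j * (j < 2)%N%:R.
Proof.
rewrite /leading_block !mxE.
case: splitP => i' Ei; rewrite !mxE; case: splitP => j' Ej; rewrite ?mxE;
  rewrite ?Ei ?Ej ?ltn_ord ?(ltnNge (2 + _)) ?leq_addr/= ?mul1r ?mulr1 ?mulr0 ?mul0r//.
by congr (A _ _); exact: val_inj.
Qed.

Lemma leading_block_cross (A : 'M[R[i]]_3) :
  leading_block A = cross_proj *m A *m cross_proj.
Proof.
apply/matrixP => i j; rewrite leading_blockE.
by rewrite mul_mx_diag mxE mul_diag_mx !mxE.
Qed.

Lemma cross_proj_idem : cross_proj *m cross_proj = cross_proj.
Proof.
rewrite /cross_proj mulmx_diag; congr diag_mx; apply/rowP => i.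
by rewrite !mxE; case: (i < 2)%N; rewrite ?mulr1 ?mulr0.
Qed.

Lemma cross_proj_conj i j : (cross_proj i j)^*%C = cross_proj i j.
Proof. by rewrite cross_projE; case: (_ && _); rewrite ?conjc1 ?conjc0. Qed.

Lemma normc_cross_proj i j : Normc.normc (cross_proj i j) <= 1.
Proof. by rewrite cross_projE; case: (_ && _); rewrite ?Normc.normc1 ?Normc.normc0. Qed.

End CrossRangeProjection.

Section ComplexLimits.
Context {R : realType} {Z : Type} {F : set_system Z} {FF : Filter F}.
Implicit Types f g : Z -> R[i].

Definition ctends f (l : R[i]) :=
  complex.Re (f z) @[z --> F] --> complex.Re l /\
  complex.Im (f z) @[z --> F] --> complex.Im l.

Lemma ctends_cst l : ctends (fun=> l) l.
Proof. by split; exact: cvg_cst. Qed.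

Lemma ctends_real (u : Z -> R) (l : R) : u @ F --> l ->
  ctends (fun z => (u z)%:C%C) l%:C%C.
Proof. by move=> ul; split => //=; exact: cvg_cst. Qed.

Lemma ctendsD f g l m : ctends f l -> ctends g m ->
  ctends (fun z => f z + g z) (l + m).
Proof.
move=> [f1 f2] [g1 g2]; split; rewrite raddfD/=.
- by under eq_fun do rewrite raddfD; exact: cvgD.
- by under eq_fun do rewrite raddfD; exact: cvgD.
Qed.

Lemma ctendsM f g l m : ctends f l -> ctends g m ->
  ctends (fun z => f z * g z) (l * m).
Proof.
move=> [f1 f2] [g1 g2]; split.
- by rewrite complex_ReM; under eq_fun do rewrite complex_ReM; apply: cvgB; exact: cvgM.
- by rewrite complex_ImM; under eq_fun do rewrite complex_ImM; apply: cvgD; exact: cvgM.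
Qed.

Lemma ctendsB f g l m : ctends f l -> ctends g m ->
  ctends (fun z => f z - g z) (l - m).
Proof.
move=> fl gm; rewrite -mulN1r; under eq_fun do rewrite -(mulN1r (g _)).
by apply: ctendsD => //; apply: ctendsM => //; exact: ctends_cst.
Qed.

Lemma ctends_conj f l : ctends f l -> ctends (fun z => (f z)^*%C) l^*%C.
Proof.
move=> [f1 f2]; split.
- rewrite (_ : complex.Re l^*%C = complex.Re l); last by case: (l).
  rewrite (_ : (fun z => _) = (fun z => complex.Re (f z)))//.
  by apply/funext => z; case: (f z).
- rewrite (_ : complex.Im l^*%C = - complex.Im l); last by case: (l).
  rewrite (_ : (fun z => _) = (fun z => - complex.Im (f z))); first exact: cvgN.
  by apply/funext => z; case: (f z).
Qed.

Lemma ctends_sum I (r : seq I) (G : I -> Z -> R[i]) (l : I -> R[i]) :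
  (forall i, ctends (G i) (l i)) ->
  ctends (fun z => \sum_(i <- r) G i z) (\sum_(i <- r) l i).
Proof.
move=> Gl; elim: r => [|i r IH].
  by under eq_fun do rewrite big_nil; rewrite big_nil; exact: ctends_cst.
by under eq_fun do rewrite big_cons; rewrite big_cons; exact: ctendsD.
Qed.

Lemma ctends_expi (u : Z -> R) (l : R) : u @ F --> l ->
  ctends (fun z => expi (u z)) (expi l).
Proof.
move=> ul; split => /=.
- by apply: cvg_comp ul _; exact: continuous_cos.
- by apply: cvg_comp ul _; exact: continuous_sin.
Qed.

Lemma ctends_near f l (e : R) : 0 < e -> ctends f l ->
  \forall z \near F, Normc.normc (f z - l) <= e.
Proof.
move=> e0 [/cvgrPdist_le f1 /cvgrPdist_le f2].
have e2 : 0 < e / 2 by lra.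
apply: filterS2 (f1 _ e2) (f2 _ e2) => z h1 h2.
apply: le_trans (normc_le_ReIm _) _.
by rewrite !raddfB/= distrC (distrC (complex.Im _)); lra.
Qed.

End ComplexLimits.

Section FarField.
Context {R : realType} {Z : Type} {F : set_system Z} {FF : Filter F}.
Variables (L k : Z -> R) (x ys : Z -> R * R) (e : Z -> R).
Hypothesis L_gt0 : forall z, 0 < L z.
Hypothesis cross1 : ((x z).1 - (ys z).1) / L z @[z --> F] --> (0 : R).
Hypothesis cross2 : ((x z).2 - (ys z).2) / L z @[z --> F] --> (0 : R).
Hypothesis offset : e z / L z @[z --> F] --> (0 : R).
Hypothesis kL_large : 1 / (k z * L z) @[z --> F] --> (0 : R).

Let rv z := pt3 (x z) 0 - pt3 (ys z) (L z + e z).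
Let r z := enorm3 (rv z).

Let L_neq0 z : L z != 0. Proof. by rewrite gt_eqF. Qed.

Lemma offset_cvg i : rv z i 0 / L z @[z --> F] --> - ((i == ord_max)%:R : R).
Proof.
under eq_fun do rewrite !mxE.
case: i => -[|[|[|//]]] ? /=.
- rewrite oppr0; exact: cross1.
- rewrite oppr0; exact: cross2.
- rewrite (_ : (fun z => _) = (fun z => - (1 + e z / L z))).
    rewrite -[X in - X]addr0; apply: cvgN; apply: cvgD offset; exact: cvg_cst.
  by apply/funext => z; rewrite sub0r mulNr mulrDl divff.
Qed.

Lemma dist_cvg : r z / L z @[z --> F] --> (1 : R).
Proof.
rewrite (_ : (fun z => _) = (fun z => Num.sqrt (\sum_i (rv z i 0 / L z) ^+ 2))); last first.
  apply/funext => z; rewrite /r /enorm3.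
  rewrite -[X in _ / X](gtr0_norm (L_gt0 z)) -sqrtr_sqr -sqrtrV ?sqr_ge0//.
  rewrite -sqrtrM; last by apply: sumr_ge0 => i _; exact: sqr_ge0.
  by rewrite mulr_suml; congr Num.sqrt; apply: eq_bigr => i _; rewrite exprMn exprVn.
rewrite -[X in _ --> X]sqrtr1.
rewrite (_ : 1 = \sum_(i < 3) (- ((i == ord_max)%:R : R)) ^+ 2); last first.
  by rewrite !big_ord_recl big_ord0/= !oppr0 !expr0n/= !add0r addr0 sqrrN expr1n.
have cS : \sum_i (rv z i 0 / L z) ^+ 2 @[z --> F] -->
    \sum_(i < 3) (- ((i == ord_max)%:R : R)) ^+ 2.
  under eq_fun do rewrite !big_ord_recl big_ord0 !expr2.
  rewrite !big_ord_recl big_ord0 !expr2.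
  do 3 (apply: cvgD; first by apply: cvgM; exact: offset_cvg).
  exact: cvg_cst.
by apply: cvg_comp cS _; exact: sqrt_continuous.
Qed.

Lemma dist_inv_cvg : L z / r z @[z --> F] --> (1 : R).
Proof.
rewrite (_ : (fun z => _) = (fun z => (r z / L z)^-1)).
  by rewrite -invr1; apply: cvgV; [exact: oner_neq0|exact: dist_cvg].
by apply/funext => z; rewrite invf_div.
Qed.

Lemma wavenumber_dist_inv_cvg : (k z * r z)^-1 @[z --> F] --> (0 : R).
Proof.
rewrite (_ : (fun z => _) = (fun z => 1 / (k z * L z) * (L z / r z))).
  by rewrite -[X in _ --> X](mul0r (1 : R)); apply: cvgM kL_large dist_inv_cvg.
by apply/funext => z; rewrite div1r !invfM -mulrA mulKf.
Qed.

(** In terms of [q = 1 / (k r)] the factor is [- q^2 + i q], an identity that persists at [k r = 0]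
    since the inverse of 0 is 0. *)
Lemma mfactor_cvg : ctends (F := F) (fun z => mfactor (k z * r z)) 0.
Proof.
pose q z := (k z * r z)^-1.
have qE z : mfactor (k z * r z) = Complex (- (q z * q z)) (q z).
  rewrite /mfactor -rmorphXn -fmorphV/= /q; set s := k z * r z.
  have [->|s0] := eqVneq s 0.
    by apply/eqP; rewrite eq_complex/= expr0n/= invr0 !(mulr0, mul0r, oppr0, subr0, addr0) eqxx.
  by apply/eqP; rewrite eq_complex/=; apply/andP; split; apply/eqP; field.
under eq_fun do rewrite qE.
split => /=; last exact: wavenumber_dist_inv_cvg.
rewrite -[X in _ --> X]oppr0 -[X in - X](mulr0 (0 : R)).
by apply: cvgN; apply: cvgM; exact: wavenumber_dist_inv_cvg.
Qed.

(** The Green matrix stripped of its phase and of [1 / (4 pi L)], written only with the ratios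
    [rv / L], [L / r] and the factor [m], each of which has a limit. *)
Definition far_amplitude z i j : R[i] :=
  (L z / r z)%:C%C * ((1 + mfactor (k z * r z)) * (i == j)%:R
   - (1 + 3 * mfactor (k z * r z)) *
     (rv z i 0 / L z * (rv z j 0 / L z) * (L z / r z) ^+ 2)%:C%C).

Lemma dyadic_green_far z i j :
  dyadic_green (pt3 (x z) 0) (pt3 (ys z) (L z + e z)) (k z) i j =
  expi (k z * r z) * ((4 * pi * L z)^-1)%:C%C * far_amplitude z i j.
Proof.
rewrite /dyadic_green /green -/(rv z) -/(r z) !mxE big_ord1 !mxE.
rewrite -[RHS]mulrA /far_amplitude -fmorphV/= -mulrA; congr (_ * _).
rewrite (_ : (4 * pi * r z)^-1 = (4 * pi * L z)^-1 * (L z / r z)); last first.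
  by rewrite !invfM -!mulrA mulKf.
rewrite rmorphM/= -[LHS]mulrA; congr (_ * (_ * (_ - _ * _%:C%C))).
rewrite /rv !mxE.
have [->|r0] := eqVneq (r z) 0; first by rewrite !(expr0n, invr0, mul0r, mulr0).
by field; rewrite r0 L_neq0.
Qed.

Lemma far_amplitude_cvg i j :
  ctends (F := F) (fun z => far_amplitude z i j) (cross_proj i j).
Proof.
(* The limit is expanded to the shape of [far_amplitude], each ratio replaced by its own limit, so
   that the limit rules match term by term. *)
have -> : cross_proj i j = 1%:C%C * ((1 + 0) * (i == j)%:R - (1 + 3 * 0) *
    (- (i == ord_max)%:R * - (j == ord_max)%:R * (1 * 1))%:C%C) :> R[i].
  rewrite cross_projE mulr0 !addr0 !mul1r mulr1 mulrNN.
  by case: i => -[|[|[|//]]] ?; case: j => -[|[|[|//]]] ? /=;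
    rewrite -?[_ == _]val_eqE/= ?(mulr0, mulr1, subr0, subrr).
apply: ctendsM; first by apply: ctends_real; exact: dist_inv_cvg.
apply: ctendsB; apply: ctendsM.
- by apply: ctendsD; [exact: ctends_cst|exact: mfactor_cvg].
- exact: ctends_cst.
- apply: ctendsD; first exact: ctends_cst.
  by apply: ctendsM; [exact: ctends_cst|exact: mfactor_cvg].
- apply: ctends_real; apply: cvgM; last by apply: cvgM; exact: dist_inv_cvg.
  by apply: cvgM; exact: offset_cvg.
Qed.

End FarField.

Section PairField.
Context {R : realType} {Z : Type} {F : set_system Z} {FF : Filter F}.
Variables (L k : Z -> R) (x ys : Z -> R * R) (es e : Z -> R) (M : R).
Hypothesis L_gt0 : forall z, 0 < L z.
Hypothesis cross1 : ((x z).1 - (ys z).1) / L z @[z --> F] --> (0 : R).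
Hypothesis cross2 : ((x z).2 - (ys z).2) / L z @[z --> F] --> (0 : R).
Hypothesis offset_s : es z / L z @[z --> F] --> (0 : R).
Hypothesis offset : e z / L z @[z --> F] --> (0 : R).
Hypothesis kL_large : 1 / (k z * L z) @[z --> F] --> (0 : R).
Hypothesis range_phase : \forall z \near F, `|k z * (es z - e z)| <= M.

Let dist (t : R) z := enorm3 (pt3 (x z) 0 - pt3 (ys z) (L z + t)).
Let rs z := dist (es z) z.
Let r z := dist (e z) z.

Lemma sqr_dist t z : dist t z ^+ 2 = ((x z).1 - (ys z).1) ^+ 2 +
  (((x z).2 - (ys z).2) ^+ 2 + (L z + t) ^+ 2).
Proof.
rewrite /dist /enorm3 sqr_sqrtr; last by apply: sumr_ge0 => i _; exact: sqr_ge0.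
by rewrite !big_ord_recl big_ord0 !mxE/= addr0 sub0r sqrrN.
Qed.

(* The cross-range offsets cancel in [rs ^ 2 - r ^ 2], so the path difference
   is the range difference up to a factor tending to 1. *)
Lemma path_difference_cvg :
  k z * (rs z - r z) - k z * (es z - e z) @[z --> F] --> (0 : R).
Proof.
have Ln0 z : L z != 0 by rewrite gt_eqF.
have rc : r z / L z @[z --> F] --> (1 : R) by exact: dist_cvg.
have rsc : rs z / L z @[z --> F] --> (1 : R) by exact: dist_cvg.
(* From [rs^2 - r^2 = (es - e) (2 L + es + e)], the quotient [q] of the path difference by the range
   difference is [(2 L + es + e) / (rs + r)]; dividing both parts by [L] shows its limit 1. *)
pose q z := ((1 + es z / L z) + (1 + e z / L z)) / (rs z / L z + r z / L z).
have qc : q z - 1 @[z --> F] --> (0 : R).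
  rewrite (_ : 0 = ((1 + 0) + (1 + 0)) / (1 + 1) - 1 :> R); last by field.
  apply: cvgB; last exact: cvg_cst.
  apply: cvgM.
    by apply: cvgD; apply: cvgD => //; exact: cvg_cst.
  by apply: cvgV; [by rewrite gt_eqF// addr_gt0|exact: cvgD].
have r0 : \forall z \near F, 0 < r z / L z.
  by move: rc => /cvgr_gt; apply; exact: ltr01.
have pathE : \forall z \near F,
    k z * (rs z - r z) - k z * (es z - e z) = k z * (es z - e z) * (q z - 1).
  apply: filterS r0 => z; rewrite pmulr_lgt0 ?invr_gt0// => rz0.
  have sum0 : rs z + r z != 0 by rewrite gt_eqF// ltr_wpDl// sqrtr_ge0.
  have key : (rs z - r z) * (rs z + r z) = (es z - e z) * (L z + es z + (L z + e z)).
    rewrite -subr_sqr /rs /r !sqr_dist; ring.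
  have -> : rs z - r z = (es z - e z) * (L z + es z + (L z + e z)) / (rs z + r z).
    by rewrite -key mulfK.
  rewrite /q; field.
  by rewrite Ln0 sum0.
apply/cvgr0Pnorm_le => eps eps0.
(* No sign is known for [M]; [|M| + 1] is a positive bound of the phase by which the tolerance can
   be divided. *)
have M1 : 0 < `|M| + 1 by rewrite ltr_wpDl.
have /cvgr0Pnorm_le/(_ (eps / (`|M| + 1))) := qc.
move=> /(_ (divr_gt0 eps0 M1)) qe.
apply: filterS3 pathE range_phase qe => z -> kM qM.
rewrite normrM (le_trans (ler_pM _ _ kM qM))//.
rewrite mulrCA ler_piMr ?(ltW eps0)// ler_pdivrMr// mul1r.
by have := ler_norm M; lra.
Qed.

Let far_s z := far_amplitude L k x ys es z.
Let far z := far_amplitude L k x ys e z.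

(** An exact identity. Conjugation makes the phases subtract, and [k (rs - r)] is split into
    [k (es - e)], which stays in the main term, and a remainder, which joins the amplitudes in a
    factor having a limit. *)
Lemma pair_field_far z i j :
  pair_field (pt3 (ys z) (L z + es z)) (pt3 (ys z) (L z + e z)) (k z) (x z) i j =
  expi (k z * (es z - e z)) * ((4 * pi * L z) ^- 2)%:C%C *
  (expi (k z * (rs z - r z) - k z * (es z - e z)) *
   \sum_l (far z i l)^*%C * far_s z l j).
Proof.
have conjE (t a : R) (w : R[i]) :
    (expi t * a%:C%C * w)^*%C = expi (- t) * a%:C%C * w^*%C.
  rewrite rmorphM; congr (_ * _); rewrite rmorphM; congr (_ * _).
  - exact: expi_conj.
  - exact: conjc_real.
rewrite mulrACA -expiD subrKC pair_fieldE !mulr_sumr; apply: eq_bigr => l _.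
apply: etrans (congr2 *%R
  (congr1 (@conjc R) (dyadic_green_far k x ys e L_gt0 z i l))
  (dyadic_green_far k x ys es L_gt0 z l j)) _.
rewrite -/(far z i l) -/(far_s z l j) -/(dist (e z) z) -/(dist (es z) z) -/(r z) -/(rs z).
move: (far z i l) (far_s z l j) => u v.
rewrite conjE mulrBr expiD -exprVn expr2 [in RHS]rmorphM/=.
ring.
Qed.

(** The second factor of [pair_field_far] tends to the product of the conjugate projection with the
    projection, which is [cross_proj] again since it is real and idempotent. The first factor has
    modulus [(4 pi L)^-2], hence an error relative to that size. *)
Lemma pair_field_near (eps : R) i j : 0 < eps ->
  \forall z \near F, Normc.normc
   (pair_field (pt3 (ys z) (L z + es z)) (pt3 (ys z) (L z + e z)) (k z) (x z) i j
    - expi (k z * (es z - e z)) * ((4 * pi * L z) ^- 2)%:C%C * cross_proj i j)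
   <= eps * (4 * pi * L z) ^- 2.
Proof.
move=> eps0.
have lim : ctends (F := F) (fun z => expi (k z * (rs z - r z) - k z * (es z - e z)) *
   \sum_l (far z i l)^*%C * far_s z l j) (cross_proj i j).
  rewrite -[X in ctends _ X]mul1r -expi0; apply: ctendsM.
    by apply: ctends_expi; exact: path_difference_cvg.
  rewrite -cross_proj_idem mxE; apply: ctends_sum => l; apply: ctendsM.
    by rewrite -cross_proj_conj; apply: ctends_conj; exact: far_amplitude_cvg.
  exact: far_amplitude_cvg.
apply: filterS (ctends_near eps0 lim) => z h.
rewrite pair_field_far -mulrBr !Normc.normcM normc_expi mul1r normc_real.
rewrite ger0_norm ?invr_ge0 ?exprn_ge0 ?mulr_ge0 ?pi_ge0 ?(ltW (L_gt0 z))//.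
by rewrite mulrC ler_wpM2r// invr_ge0 exprn_ge0// !mulr_ge0 ?pi_ge0// ltW.
Qed.

End PairField.

(** * Quantitative estimates *)

Section MatrixBounds.
Context {R : realType}.

Lemma mxnormF_ge0 m n (A : 'M[R[i]]_(m, n)) : 0 <= mxnormF A.
Proof. exact: sqrtr_ge0. Qed.

Lemma normc_le_mxnormF m n (A : 'M[R[i]]_(m, n)) i j :
  Normc.normc (A i j) <= mxnormF A.
Proof.
rewrite -[leLHS]ger0_norm ?normc_ge0// -sqrtr_sqr ler_wsqrtr//.
rewrite (bigD1 i)//= (bigD1 j)//= -addrA lerDl addr_ge0//.
  by apply: sumr_ge0 => l _; exact: sqr_ge0.
by apply: sumr_ge0 => l _; apply: sumr_ge0 => q _; exact: sqr_ge0.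
Qed.

Lemma mxnormF_le_entries (A : 'M[R[i]]_3) (e : R) : 0 <= e ->
  (forall i j, Normc.normc (A i j) <= e) -> mxnormF A <= 3 * e.
Proof.
move=> e0 Ae; rewrite -[leRHS]ger0_norm ?mulr_ge0// -[leRHS]sqrtr_sqr ler_wsqrtr//.
have -> : (3 * e) ^+ 2 = \sum_(i < 3) \sum_(j < 3) e ^+ 2.
  by rewrite !sumr_const card_ord; ring.
by apply: ler_sum => i _; apply: ler_sum => j _; rewrite ler_sqr ?nnegrE ?normc_ge0.
Qed.

(** Exchanging [H] for [G] one factor at a time gives two error terms for each of the nine index
    pairs, whence 18. *)
Lemma sandwich_dist (H G A : 'M[R[i]]_3) (h eta : R) :
  0 <= eta ->
  (forall i j, Normc.normc (H i j) <= h) -> (forall i j, Normc.normc (G i j) <= h) ->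
  (forall i j, Normc.normc (H i j - G i j) <= eta) ->
  forall i j, Normc.normc ((H *m A *m H^T) i j - (G *m A *m G^T) i j) <=
    18 * (eta * h * mxnormF A).
Proof.
move=> eta0 Hh Gh HG i j.
have h0 : 0 <= h by exact: le_trans (normc_ge0 _) (Hh 0 0).
have E (X : 'M[R[i]]_3) : (X *m A *m X^T) i j =
    \sum_l \sum_m X i m * A m l * X j l.
  by rewrite !mxE; apply: eq_bigr => l _; rewrite !mxE mulr_suml.
rewrite !E -sumrB.
have -> : 18 * (eta * h * mxnormF A) =
    \sum_(l < 3) \sum_(m < 3) 2 * (eta * h * mxnormF A).
  by rewrite !sumr_const card_ord; ring.
apply: le_trans (normc_sum_le _ _ _) _; apply: ler_sum => l _.
rewrite -sumrB; apply: le_trans (normc_sum_le _ _ _) _; apply: ler_sum => m _.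
rewrite (_ : H i m * A m l * H j l - G i m * A m l * G j l =
  (H i m - G i m) * H j l * A m l + (H j l - G j l) * G i m * A m l); last by ring.
apply: le_trans (normc_triangle _ _) _; rewrite [leRHS](_ : _ = eta * h * mxnormF A + eta * h * mxnormF A); last by ring.
apply: lerD; rewrite !Normc.normcM; apply: ler_pM;
  rewrite ?mulr_ge0 ?normc_ge0 ?normc_le_mxnormF//; apply: ler_pM => //;
  exact: normc_ge0.
Qed.

End MatrixBounds.

Section FixedParameters.
Context {R : realType}.
Variables (a c L w0 B : R) (ystar y : 'cV[R]_3) (delta eps : R).
Hypotheses (a_gt0 : 0 < a) (L_gt0 : 0 < L) (B_gt0 : 0 < B).
Hypotheses (eps_ge0 : 0 <= eps) (eps_le1 : eps <= 1).

Let band := [set w : R | `|w - w0| < B / 2].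
Let kappa0 := (4 * pi * L) ^- 2.
Let kappa := a ^+ 2 / (16 * pi * L ^+ 2).

(** The only asymptotic input of this section: everything derived from it is an explicit inequality
    at one value of the parameters. *)
Hypothesis pair_field_approx : forall w x, band w -> array_disk a x ->
  forall i j, Normc.normc (pair_field ystar y (w / c) x i j -
    expi (w / c * delta) * kappa0%:C%C * cross_proj i j) <= eps * kappa0.

Let kappa0_ge0 : 0 <= kappa0.
Proof. by rewrite invr_ge0 sqr_ge0. Qed.

Let kappaE : kappa0 * (pi * a ^+ 2) = kappa.
Proof.
rewrite /kappa0 /kappa; move: (pi : R) (pi_gt0 R) => u u0; field.
by rewrite (gt_eqF u0) (gt_eqF L_gt0).
Qed.

Let kappa_ge0 : 0 <= kappa.
Proof.
rewrite -kappaE; apply: mulr_ge0 => //.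
by apply: mulr_ge0; [exact: pi_ge0|exact: sqr_ge0].
Qed.

Let disk_fin : (lebesgue2 (array_disk a) < +oo)%E.
Proof. by rewrite lebesgue2_disk// ltry. Qed.

Let cmeasurable_pair w i j :
  cmeasurable (fun x : measurableTypeR R * measurableTypeR R =>
    pair_field ystar y (w / c) x i j).
Proof.
apply: cmeasurable_pair_field; first exact: measurable_cst.
- exact: measurable_fst.
- exact: measurable_snd.
Qed.

Let normc_main w i j (K : R) : 0 <= K ->
  Normc.normc (expi (w / c * delta) * K%:C%C * cross_proj i j) <= K.
Proof.
move=> K0; rewrite !Normc.normcM normc_expi mul1r normc_real ger0_norm//.
by rewrite ler_piMr// normc_cross_proj.
Qed.

Lemma pair_field_cintegrable w i j : band w ->
  cintegrable lebesgue2 (array_disk a) (fun x => pair_field ystar y (w / c) x i j).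
Proof.
move=> bw; apply: (@cintegrable_bounded _ _ _ _ _ _ _ (eps * kappa0 + kappa0)) => //.
  exact: measurable_array_disk.
move=> x Dx; rewrite -[X in Normc.normc X](subrK (expi (w / c * delta) *
  kappa0%:C%C * cross_proj i j)).
apply: le_trans (normc_triangle _ _) _; apply: lerD; last exact: normc_main.
exact: pair_field_approx.
Qed.

(** The main term does not depend on the array point, so it integrates exactly to the area times
    itself; the error picks up the factor 2 of [normc_Cintegral_le]. *)
Lemma focus_approx w i j : band w ->
  Normc.normc (focus a ystar y (w / c) i j -
    expi (w / c * delta) * kappa%:C%C * cross_proj i j) <= 2 * (eps * kappa).
Proof.
move=> bw; pose m := expi (w / c * delta) * kappa0%:C%C * cross_proj i j.
have mD := @measurable_array_disk R a.
have Df := disk_fin.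
rewrite (_ : _ - _ = Cintegral lebesgue2 (array_disk a)
    (fun x => pair_field ystar y (w / c) x i j + - m)).
  have -> : 2 * (eps * kappa) = 2 * (eps * kappa0 * fine (lebesgue2 (array_disk a))).
    by rewrite lebesgue2_disk//= -kappaE !mulrA.
  apply: normc_Cintegral_le => //; first by apply: cmeasurableB => //; exact: cmeasurable_cst.
  by move=> x Dx; exact: pair_field_approx.
rewrite CintegralD//; last 2 first.
- exact: pair_field_cintegrable.
- exact: (@cintegrable_bounded _ _ _ _ _ _ _ (Normc.normc (- m))).
rewrite Cintegral_cst// (_ : fine _ = pi * a ^+ 2); last first.
  exact: (congr1 fine (lebesgue2_disk a_gt0)).
rewrite mxE mulNr; congr (_ - _).
rewrite /m -kappaE rmorphM/=; ring.
Qed.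

(** Here 108 is [18 * 2 * 3]: the error of [H] is [2 eps kappa], and its entries are at most
    [2 eps kappa + kappa <= 3 kappa] because [eps <= 1]. The phase doubles since [G] occurs on both
    sides of [alpha]. *)
Lemma kirchhoff_single_approx (alpha : 'M[R[i]]_3) w i j : band w ->
  Normc.normc (kirchhoff_single a ystar alpha y (w / c) i j -
    expi (2 * delta / c * w) * (kappa ^+ 2)%:C%C * leading_block alpha i j) <=
  108 * (eps * kappa ^+ 2 * mxnormF alpha).
Proof.
move=> bw; rewrite kirchhoff_single_focus => [|i' j']; last exact: pair_field_cintegrable.
pose s := expi (w / c * delta) * kappa%:C%C.
pose G : 'M[R[i]]_3 := s *: cross_proj.
have Gk i' j' : Normc.normc (G i' j') <= kappa by rewrite mxE; exact: normc_main.
have HG i' j' : Normc.normc (focus a ystar y (w / c) i' j' - G i' j') <= 2 * (eps * kappa).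
  by rewrite [G _ _]mxE; exact: focus_approx.
have -> : expi (2 * delta / c * w) * (kappa ^+ 2)%:C%C * leading_block alpha i j =
    (G *m alpha *m G^T) i j.
  rewrite /G linearZ/= -!scalemxAl -scalemxAr tr_diag_mx -leading_block_cross !mxE.
  rewrite (_ : 2 * delta / c * w = w / c * delta + w / c * delta); last by ring.
  by rewrite expiD expr2 rmorphM/= /s; ring.
have ek : eps * kappa <= kappa by rewrite ler_piMl.
have Hk i' j' : Normc.normc (focus a ystar y (w / c) i' j') <= 3 * kappa.
  rewrite -[X in Normc.normc X](subrK (G i' j')).
  apply: le_trans (normc_triangle _ _) _.
  have sum3 (u v t q : R) : u <= 2 * q -> v <= t -> q <= t -> u + v <= 3 * t by lra.
  exact: sum3 (HG _ _) (Gk _ _) ek.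
have Gk3 i' j' : Normc.normc (G i' j') <= 3 * kappa.
  by apply: le_trans (Gk _ _) _; rewrite ler_peMl// ler1n.
have eta0 : 0 <= 2 * (eps * kappa) by apply: mulr_ge0 => //; exact: mulr_ge0.
apply: le_trans (sandwich_dist alpha eta0 Hk Gk3 HG i j) _.
by rewrite le_eqVlt; apply/orP; left; apply/eqP; ring.
Qed.

Let cmeasurable_single (alpha : 'M[R[i]]_3) i j :
  cmeasurable (fun w : measurableTypeR R =>
    (focus a ystar y (w / c) *m alpha *m (focus a ystar y (w / c))^T) i j).
Proof.
under eq_fun do rewrite !mxE.
apply: cmeasurable_sum => l; apply: cmeasurableM; last first.
  by under eq_fun do rewrite mxE; exact: cmeasurable_focus.
under eq_fun do rewrite mxE.
apply: cmeasurable_sum => m; apply: cmeasurableM; last exact: cmeasurable_cst.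
exact: cmeasurable_focus.
Qed.

(** The oscillatory integral is left unevaluated, as it is bounded away from the scatterer but
    computed at it. The constant 216 is twice 108, again from separate components. *)
Lemma kirchhoff_approx (alpha : 'M[R[i]]_3) i j :
  Normc.normc (kirchhoff a c w0 B ystar alpha y i j -
    (kappa ^+ 2)%:C%C * leading_block alpha i j *
    Cintegral (@lebesgue_measure R) band (fun w => expi (2 * delta / c * w))) <=
  216 * (eps * kappa ^+ 2 * mxnormF alpha) * B.
Proof.
rewrite mxE.
(* The factorized form agrees with the image on the band, where integrability is known, and is
   measurable on the whole line. *)
pose S w := (focus a ystar y (w / c) *m alpha *m (focus a ystar y (w / c))^T) i j.
pose C := (kappa ^+ 2)%:C%C * leading_block alpha i j.
have SE w : band w -> kirchhoff_single a ystar alpha y (w / c) i j = S w.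
  by move=> bw; rewrite kirchhoff_single_focus// => i' j'; exact: pair_field_cintegrable.
have -> : Cintegral (@lebesgue_measure R) [set w | `|w - w0| < B / 2]
    (fun w => kirchhoff_single a ystar alpha y (w / c) i j) =
    Cintegral (@lebesgue_measure R) band S.
  by congr Complex; apply: eq_Rintegral => w; rewrite inE => bw; rewrite SE.
have mb := @measurable_band R w0 B.
have bfin : (lebesgue_measure band < +oo)%E by rewrite lebesgue_band// ltry.
have mE : cmeasurable (fun w : measurableTypeR R => - C * expi (2 * delta / c * w)).
  apply: cmeasurableM; first exact: cmeasurable_cst.
  by apply: cmeasurable_expi; exact: mulrl_measurable.
have bE w : Normc.normc (- C * expi (2 * delta / c * w)) <= Normc.normc C.
  by rewrite Normc.normcM normc_opp normc_expi mulr1.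
have mS : cmeasurable (S : measurableTypeR R -> _) by exact: cmeasurable_single.
have near w : band w -> Normc.normc (S w + - C * expi (2 * delta / c * w)) <=
    108 * (eps * kappa ^+ 2 * mxnormF alpha).
  move=> bw; have := kirchhoff_single_approx alpha i j bw; rewrite SE//.
  by rewrite mulNr (mulrC C) /C (mulrA (expi _)).
have iE := @cintegrable_bounded _ _ _ (@lebesgue_measure R) band mb _ _ bfin mE (fun w _ => bE w).
have iS : cintegrable (@lebesgue_measure R) band S.
  apply: (@cintegrable_bounded _ _ _ _ _ _ _
    (108 * (eps * kappa ^+ 2 * mxnormF alpha) + Normc.normc C)) => // w bw.
  rewrite -[X in Normc.normc X](addrK (- C * expi (2 * delta / c * w))).
  apply: le_trans (normc_triangle _ _) _; rewrite normc_opp; apply: lerD => //.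
  exact: near.
have iexp : cintegrable (@lebesgue_measure R) band (fun w => expi (2 * delta / c * w)).
  apply: (@cintegrable_bounded _ _ _ _ _ _ _ 1) => // [|w _]; last by rewrite normc_expi.
  by apply: cmeasurable_expi; exact: mulrl_measurable.
rewrite -/C -mulNr -CintegralZ// -CintegralD//.
apply: le_trans (normc_Cintegral_le mb bfin (cmeasurableD mS mE) near) _.
rewrite (_ : fine _ = B); last exact: (congr1 fine (lebesgue_band w0 B_gt0)).
by rewrite le_eqVlt; apply/orP; left; apply/eqP; ring.
Qed.

End FixedParameters.

(** * Uniform estimates in the Fraunhofer regime *)

Section Regime.
Context {R : realType} {T : Type} (F : filter_on T).
Variables (p : T -> imaging_params R) (K : R).
Hypothesis p_adm : forall t, admissible (p t).
Hypothesis F_regime : fraunhofer F p.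

Let c t := wave_speed (p t).
Let B t := bandwidth (p t).
Let a t := array_radius (p t).
Let L t := standoff (p t).
Let b t := cross_win (p t).
Let h t := range_win (p t).

(* A point is ((((ys, es), e), w), x): scatterer (ys, L + es), imaging point
   (ys, L + e), frequency w, and array point x. *)
Let Q : Type := (((((R * R) * R) * R) * R) * (R * R))%type.

Let W t : set Q := [set q | [/\ window K (p t) q.1.1.1,
  window K (p t) (q.1.1.1.1, q.1.1.2), band (p t) q.1.2 & array_disk (a t) q.2]].

Let U := uniformly F W.

#[local] Instance uniform_W_filter : Filter (uniform_system F W) :=
  uniform_system_filter W (filter_class F).

Let U_W : \forall z \near U, W z.1 z.2.
Proof. by apply: (@filterE _ F) => t q. Qed.

(** Forgetting everything but the frequency transports the limits of the regime, stated along the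
    band alone, to the larger index. *)
Let U_band : (fun z : T * Q => (z.1, z.2.1.2)) @ U --> uniformly F (fun t => band (p t)).
Proof.
move=> E; apply: (@filterS _ F) => t tE q [_ _ bw _]; exact: tE.
Qed.

Let L_gt0 t : 0 < L t. Proof. by have [] := p_adm t. Qed.

Let a_gt0 t : 0 < a t. Proof. by have [] := p_adm t. Qed.

Let B_gt0 t : 0 < B t. Proof. by have [] := p_adm t. Qed.

Let h_gt0 t : 0 < h t. Proof. by have [_ _ _ _ []] := p_adm t. Qed.

Let cvg_band (f : T * R -> R) (l : R) :
  f @ uniformly F (fun t => band (p t)) --> l ->
  f (z.1, z.2.1.2) @[z --> U] --> l.
Proof. by move=> fl; apply: cvg_comp U_band fl. Qed.

Let aL : a z.1 / L z.1 @[z --> U] --> (0 : R).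
Proof. by have [_ [aL _ _] _ _ _] := F_regime; apply: cvg_band aL. Qed.

Let bL : b z.1 / L z.1 @[z --> U] --> (0 : R).
Proof. by have [_ [_ bL _] _ _ _] := F_regime; apply: cvg_band bL. Qed.

Let hL : h z.1 / L z.1 @[z --> U] --> (0 : R).
Proof. by have [_ [_ _ hL] _ _ _] := F_regime; apply: cvg_band hL. Qed.

Let dominated_cvg (f g : T * Q -> R) :
  (\forall z \near U, `|f z| <= g z) -> g @ U --> (0 : R) -> f @ U --> (0 : R).
Proof.
move=> fg /cvgr0Pnorm_le g0; apply/cvgr0Pnorm_le => e e0.
apply: (@filterS2 _ U _ _ _ _ _ fg (g0 _ e0)) => z fgz; apply: le_trans.
exact: le_trans fgz (ler_norm _).
Qed.

Let normr1_enorm2 (x : R * R) : `|x.1| <= enorm2 x.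
Proof. by rewrite -sqrtr_sqr ler_wsqrtr// lerDl sqr_ge0. Qed.

Let normr2_enorm2 (x : R * R) : `|x.2| <= enorm2 x.
Proof. by rewrite -sqrtr_sqr ler_wsqrtr// lerDr sqr_ge0. Qed.

Let cross_cvg (f : R * R -> R) : (forall x, `|f x| <= enorm2 x) ->
  (f z.2.2 - f z.2.1.1.1.1) / L z.1 @[z --> U] --> (0 : R).
Proof.
move=> f_le; apply: (@dominated_cvg _ (fun z => a z.1 / L z.1 + K * (b z.1 / L z.1))).
  apply: (@filterS _ U _ _ _ _ U_W) => -[t q] /= [[wys _] _ _ dx].
  rewrite normrM normfV (gtr0_norm (L_gt0 _)) mulrA -mulrDl ler_pM2r ?invr_gt0//.
  apply: le_trans (ler_normB _ _) _; apply: lerD.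
  - exact: le_trans (f_le _) dx.
  - exact: le_trans (f_le _) wys.
rewrite (_ : 0 = 0 + K * 0 :> R); last by rewrite mulr0 addr0.
by apply: cvgD => //; apply: cvgM => //; exact: cvg_cst.
Qed.

Let range_cvg (f : Q -> R) : (forall t q, W t q -> `|f q| <= K * h t) ->
  f z.2 / L z.1 @[z --> U] --> (0 : R).
Proof.
move=> f_le; apply: (@dominated_cvg _ (fun z => K * (h z.1 / L z.1))).
  apply: (@filterS _ U _ _ _ _ U_W) => -[t q] /= Wq.
  by rewrite normrM normfV (gtr0_norm (L_gt0 _)) mulrA ler_pM2r ?invr_gt0// f_le.
rewrite (_ : 0 = K * 0 :> R); last by rewrite mulr0.
by apply: cvgM => //; exact: cvg_cst.
Qed.

Let range_phase_bounded : exists M : R, \forall z \near U,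
  `|z.2.1.2 / c z.1 * (z.2.1.1.1.2 - z.2.1.1.2)| <= M.
Proof.
have [_ _ _ _ /eqO_exP[C C0 kh]] := F_regime.
(* Both range offsets are at most [|K| h], and [C] bounds [k h]. *)
exists (2 * (`|K| * C)).
have := U_band kh; rewrite /= => khU.
apply: (@filterS2 _ U _ _ _ _ _ U_W khU) => -[t [[[[ys es] e] w] x]] /= [[_ Wes] [_ We] _ _].
rewrite normr1 mulr1 => {}kh.
have Kh : `|es - e| <= 2 * (`|K| * h t).
  apply: le_trans (ler_normB _ _) _.
  have : K * h t <= `|K| * h t by rewrite ler_pM2r// ler_norm.
  by rewrite /= in Wes We; rewrite /h; lra.
rewrite normrM; apply: le_trans (ler_wpM2l _ Kh) _ => //.
rewrite mulrCA ler_pM2l// mulrCA ler_wpM2l//.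
by rewrite -[h t]gtr0_norm// -normrM.
Qed.

Let pair_field_regime (eps : R) : 0 < eps ->
  \forall t \near F, forall q, W t q -> forall i j, Normc.normc
   (pair_field (pt3 q.1.1.1.1 (L t + q.1.1.1.2)) (pt3 q.1.1.1.1 (L t + q.1.1.2))
      (q.1.2 / c t) q.2 i j
    - expi (q.1.2 / c t * (q.1.1.1.2 - q.1.1.2)) * ((4 * pi * L t) ^- 2)%:C%C *
      cross_proj i j)
   <= eps * (4 * pi * L t) ^- 2.
Proof.
move=> eps0; have [M phase] := range_phase_bounded.
have kL_cvg : 1 / (z.2.1.2 / c z.1 * L z.1) @[z --> U] --> (0 : R).
  by have [kL _ _ _ _] := F_regime; apply: cvg_band kL.
have es_cvg := @range_cvg (fun q => q.1.1.1.2) (fun t q Wq => let: And4 H _ _ _ := Wq in H.2).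
have e_cvg := @range_cvg (fun q => q.1.1.2) (fun t q Wq => let: And4 _ H _ _ := Wq in H.2).
have key i j := @pair_field_near R (T * Q)%type U (filter_class U) (fun z => L z.1)
  (fun z => z.2.1.2 / c z.1) (fun z => z.2.2) (fun z => z.2.1.1.1.1)
  (fun z => z.2.1.1.1.2) (fun z => z.2.1.1.2) M (fun z => L_gt0 z.1)
  (cross_cvg normr1_enorm2) (cross_cvg normr2_enorm2) es_cvg e_cvg
  kL_cvg phase eps i j eps0.
(* The nine eventual bounds, one for each entry, are merged into one. *)
have {}key := @filter_forall _ ('I_3 * 'I_3)%type _ U (filter_class U) (fun ij => key ij.1 ij.2).
by apply: (@filterS _ F) key => t tP q Wq i j; exact: (tP q Wq (i, j)).
Qed.

Lemma kirchhoff_regime (alpha : T -> 'M[R[i]]_3) (eps : R) : 0 < eps ->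
  \forall t \near F, forall ys es e, window K (p t) (ys, es) -> window K (p t) (ys, e) ->
  forall i j, Normc.normc
    (kirchhoff (a t) (c t) (central_freq (p t)) (B t) (pt3 ys (L t + es)) (alpha t)
       (pt3 ys (L t + e)) i j -
     ((a t ^+ 2 / (16 * pi * L t ^+ 2)) ^+ 2)%:C%C * leading_block (alpha t) i j *
     Cintegral (@lebesgue_measure R) [set w | `|w - central_freq (p t)| < B t / 2]
       (fun w => expi (2 * (es - e) / c t * w))) <=
  216 * (eps * (a t ^+ 2 / (16 * pi * L t ^+ 2)) ^+ 2 * mxnormF (alpha t)) * B t.
Proof.
(* The fixed-parameter estimates require a tolerance of at most 1. *)
move=> eps0; have e0 : 0 < Num.min eps 1 by rewrite lt_min eps0 ltr01.
apply: filterS (pair_field_regime e0) => t tP ys es e Wes We i j.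
apply: le_trans (@kirchhoff_approx R _ _ _ _ _ _ _ _ (Num.min eps 1) (a_gt0 t)
  (L_gt0 t) (B_gt0 t) (ltW e0) _ _ (alpha t) i j) _.
- by rewrite ge_min lexx orbT.
- move=> w x bw Dx i' j'; apply: (tP ((((ys, es), e), w), x)); split => //=.
  (* The open band of integration lies in the closed band of the regime. *)
  by move: bw; rewrite /= ltr_distl /band /= => /andP[/ltW -> /ltW ->].
rewrite ler_wpM2r ?(ltW (B_gt0 t))// ler_wpM2l// ler_wpM2r ?mxnormF_ge0//.
by rewrite ler_wpM2r ?sqr_ge0// ge_min lexx.
Qed.

End Regime.

(** * Amplitude bounds and the two asymptotic statements *)

Lemma normc_leading_block (R : realType) (A : 'M[R[i]]_3) i j :
  Normc.normc (leading_block A i j) <= mxnormF A.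
Proof.
rewrite leading_blockE; case: (i < 2)%N; case: (j < 2)%N;
  rewrite ?(mul1r, mulr1, mul0r, mulr0) ?Normc.normc0 ?mxnormF_ge0//.
exact: normc_le_mxnormF.
Qed.

Lemma amplitude_sqr (R : realType) (a L : R) : 0 < L ->
  (a ^+ 2 / (16 * pi * L ^+ 2)) ^+ 2 = a ^+ 4 / ((16 * pi) ^+ 2 * L ^+ 4).
Proof.
move=> L0; move: (pi : R) (pi_gt0 R) => u u0; field.
by rewrite (gt_eqF u0) (gt_eqF L0).
Qed.

Lemma amplitude_le (R : realType) (a L : R) : 0 < a -> 0 < L ->
  (a ^+ 2 / (16 * pi * L ^+ 2)) ^+ 2 <= a ^+ 4 / L ^+ 4.
Proof.
move=> a0 L0; rewrite amplitude_sqr// ler_pM2l ?exprn_gt0//.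
rewrite lef_pV2 ?posrE ?mulr_gt0 ?exprn_gt0 ?mulr_gt0 ?pi_gt0//.
rewrite ler_peMl ?exprn_ge0 ?(ltW L0)// exprn_ege1//.
by have := pi_ge2 R; lra.
Qed.

Theorem proposition3p3 (R : realType) (T : Type) (F : filter_on T)
    (p : T -> imaging_params R) (alpha : T -> 'M[R[i]]_3) (K : R)
    (p_adm : forall t, admissible (p t))
    (F_regime : fraunhofer F p)
    (alpha_sym : forall t, (alpha t)^T = alpha t)
    (alpha_bnd : ((fun t => mxnormF (alpha t)) : T -> R^o)
                   =O_F ((fun=> 1) : T -> R^o)) :
  let c t := wave_speed (p t) in
  let B t := bandwidth (p t) in
  let a t := array_radius (p t) in
  let L t := standoff (p t) in
  let I_KM t (ystar y : 'cV[R]_3) :=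
    kirchhoff (a t) (c t) (central_freq (p t)) (B t) ystar (alpha t) y in
  (* z = (t, ((ys, etas), eta)): scatterer (ys, L + etas), imaging point (ys, L + eta) *)
  (let G1 := uniformly F (fun t => [set q : ((R * R) * R) * R |
       [/\ window K (p t) q.1, window K (p t) (q.1.1, q.2) & q.2 != q.1.2]]) in
   exists f g : T * (((R * R) * R) * R) -> R^o,
     [/\ f =O_G1 ((fun z => c z.1 / (B z.1 * `|z.2.2 - z.2.1.2|)) : _ -> R^o),
         g =o_G1 ((fun=> 1) : _ -> R^o) &
         \forall z \near G1,
           mxnormF (I_KM z.1 (pt3 z.2.1.1 (L z.1 + z.2.1.2))
                             (pt3 z.2.1.1 (L z.1 + z.2.2)))
           = B z.1 * (a z.1 ^+ 4 / L z.1 ^+ 4) * (f z + g z)]) /\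
  (* z = (t, (ys, etas)) *)
  (let G2 := uniformly F (fun t => window K (p t)) in
   exists E : T * ((R * R) * R) -> 'M[R[i]]_3,
     ((fun z => mxnormF (E z)) : _ -> R^o)
       =o_G2 ((fun z => a z.1 ^+ 4 / L z.1 ^+ 4) : _ -> R^o) /\
     \forall z \near G2,
       let ystar := pt3 z.2.1 (L z.1 + z.2.2) in
       I_KM z.1 ystar ystar
       = (B z.1)%:C%C *:
         ((a z.1 ^+ 4 / ((16 * pi) ^+ 2 * L z.1 ^+ 4))%:C%C
            *: leading_block (alpha z.1) + E z)).
Proof.
move=> c B a L I_KM.
have [M M0 alphaM] : exists2 M : R, 0 < M & \forall t \near F, mxnormF (alpha t) <= M.
  move: (alpha_bnd) => /eqO_exP[M M0 alphaM]; exists M => //.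
  apply: filterS alphaM => t; rewrite normr1 mulr1; apply: le_trans.
  exact: ler_norm.
(* Here 648 is [3 * 216]: each entry then has error at most [eps A B / 3], and the Frobenius norm of
   a 3 by 3 matrix is at most three times the largest entry. *)
have coef0 eps : 0 < eps -> 0 < eps / (648 * M).
  by move=> e0; apply: (divr_gt0 e0); apply: mulr_gt0 M0; rewrite ltr0n.
have a0 t : 0 < a t by have [] := p_adm t.
have L0 t : 0 < L t by have [] := p_adm t.
have B0 t : 0 < B t by have [] := p_adm t.
have c0 t : 0 < c t by have [] := p_adm t.
pose A t := a t ^+ 4 / L t ^+ 4.
have A0 t : 0 < A t by rewrite divr_gt0// exprn_gt0.
pose kap t := (a t ^+ 2 / (16 * pi * L t ^+ 2)) ^+ 2.
have kap0 t : 0 <= kap t by exact: sqr_ge0.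
have kapA t : kap t <= A t by exact: amplitude_le.
have regime eps (eps0 : 0 < eps) := @filterI _ F (filter_class F) _ _
  (@kirchhoff_regime R T F p K p_adm F_regime alpha _ (coef0 _ eps0)) alphaM.
have small eps t : 0 < eps -> mxnormF (alpha t) <= M ->
    216 * (eps / (648 * M) * kap t * mxnormF (alpha t)) * B t <= eps * A t * B t / 3.
  move=> eps0 alM.
  have -> : eps * A t * B t / 3 = 216 * (eps / (648 * M) * A t * M) * B t.
    by field; rewrite gt_eqF.
  rewrite (ler_pM2r (B0 t)) ler_pM2l//.
  have mono (x k k' m : R) : 0 <= x -> 0 <= k -> k <= k' -> 0 <= m -> m <= M ->
      x * k * m <= x * k' * M.
    move=> x0 k0 kk' m0 mM; apply: ler_pM => //; first exact: mulr_ge0.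
    exact: ler_wpM2l.
  by apply: mono (ltW (coef0 _ eps0)) (kap0 t) (kapA t) (mxnormF_ge0 _) alM.
split.
- move=> G1.
  pose D t := B t * A t.
  have D0 t : 0 < D t by rewrite mulr_gt0.
  pose n (z : T * (((R * R) * R) * R)) := mxnormF (I_KM z.1 (pt3 z.2.1.1 (L z.1 + z.2.1.2))
    (pt3 z.2.1.1 (L z.1 + z.2.2))) / D z.1.
  pose v (z : T * (((R * R) * R) * R)) := c z.1 / (B z.1 * `|z.2.2 - z.2.1.2|).
  have n0 z : 0 <= n z by rewrite divr_ge0 ?mxnormF_ge0 ?ltW.
  have v0 z : 0 <= v z.
    apply: divr_ge0; first exact: ltW.
    by apply: mulr_ge0; first exact: ltW.
  have u0 z : 0 <= 6 * M * v z by apply: mulr_ge0 => //; rewrite mulr_ge0// ltW.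
  (* The normalized norm [n] is cut at [6 M v]: the truncation is the [O] term by construction, and
     the excess is the [o] term once [n <= 6 M v + eps] holds eventually. *)
  exists (fun z => Num.min (n z) (6 * M * v z)).
  exists (fun z => n z - Num.min (n z) (6 * M * v z)); split.
  + apply/eqO_exP; exists (6 * M); first by rewrite mulr_gt0.
    apply: filterE => z; rewrite ger0_norm ?le_min ?n0 ?u0//.
    apply: (@le_trans _ _ (6 * M * v z)); first by rewrite ge_min lexx orbT.
    by apply: ler_wpM2l; [rewrite mulr_ge0// ltW|exact: ler_norm].
  + apply/eqoP => eps eps0; move: (regime eps eps0).
    apply: (@filterS _ F) => t [tI alM] [[ys es] e] /= [wes we ees].
    rewrite normr1 mulr1 ger0_norm ?subr_ge0 ?ge_min ?lexx//.
    suff nv : n (t, ((ys, es), e)) <= 6 * M * v (t, ((ys, es), e)) + eps.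
      by rewrite lerBlDr /Num.min; case: ifP => _; lra.
    have de : 0 < `|e - es| by rewrite normr_gt0 subr_eq0.
    rewrite /n /= ler_pdivrMr//.
    (* The frequency of the oscillation is [s = 2 (es - e) / c], so [4 / |s|] is [2 c / |e - es|];
       the factor 3 from the Frobenius norm completes the 6. *)
    have -> : (6 * M * v (t, ((ys, es), e)) + eps) * D t =
        3 * (A t * M * (2 * c t / `|e - es|) + eps * A t * B t / 3).
      by rewrite /v /D /=; field; rewrite !gt_eqF.
    apply: mxnormF_le_entries => [|i j].
      apply: addr_ge0.
        apply: mulr_ge0; first by apply: mulr_ge0; exact: ltW.
        by apply: divr_ge0 => //; apply: mulr_ge0 => //; exact: ltW.
      apply: divr_ge0 => //; apply: mulr_ge0; last exact: ltW.
      by apply: mulr_ge0; exact: ltW.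
    rewrite -[X in Normc.normc X](subrK ((kap t)%:C%C * leading_block (alpha t) i j *
      Cintegral (@lebesgue_measure R) [set w | `|w - central_freq (p t)| < B t / 2]
       (fun w => expi (2 * (es - e) / c t * w)))).
    apply: le_trans (normc_triangle _ _) _; rewrite addrC; apply: lerD.
      rewrite !Normc.normcM normc_real ger0_norm//.
      apply: ler_pM; [by apply: mulr_ge0 (normc_ge0 _)|exact: normc_ge0| |].
        apply: ler_pM => //; first exact: normc_ge0.
        exact: le_trans (normc_leading_block _ _ _) alM.
      have s0 : 2 * (es - e) / c t != 0.
        have d0 : es - e != 0 by rewrite subr_eq0 eq_sym.
        by rewrite !mulf_neq0// invr_eq0 gt_eqF.
      apply: le_trans (normc_Cintegral_expi _ s0 (B0 t)) _.
      rewrite !normrM normfV (gtr0_norm (c0 t)) gtr0_norm// (distrC es).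
      by rewrite le_eqVlt; apply/orP; left; apply/eqP; field; rewrite !gt_eqF.
    exact: le_trans (tI _ _ _ wes we i j) (small _ _ eps0 alM).
  + apply: filterE => z; rewrite subrKC /n mulrCA divff ?mulr1// gt_eqF//.
    exact: D0.
- move=> G2.
  (* The remainder is defined by the required identity, so that only its size has to be proved. *)
  exists (fun z => (B z.1)^-1%:C%C *: I_KM z.1 (pt3 z.2.1 (L z.1 + z.2.2))
      (pt3 z.2.1 (L z.1 + z.2.2)) -
    (a z.1 ^+ 4 / ((16 * pi) ^+ 2 * L z.1 ^+ 4))%:C%C *: leading_block (alpha z.1)).
  split; last first.
    apply: filterE => z /=; rewrite subrKC scalerA -rmorphM/= divff ?gt_eqF//.
    by rewrite scale1r.
  apply: (eqoP _ _ _).2 => eps eps0; move: (regime eps eps0).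
  apply: (@filterS _ F) => t [tI alM] [ys es] /= wes.
  rewrite ger0_norm ?mxnormF_ge0// gtr0_norm ?A0// -/(A t).
  have -> : eps * A t = 3 * ((B t)^-1 * (eps * A t * B t / 3)).
    by field; rewrite gt_eqF.
  apply: mxnormF_le_entries => [|i j].
    apply: mulr_ge0; first by rewrite invr_ge0 ltW.
    apply: divr_ge0 => //; apply: mulr_ge0; last exact: ltW.
    by apply: mulr_ge0; exact: ltW.
  have entryE (s u : R[i]) (X Y : 'M[R[i]]_3) :
    (s *: X - u *: Y) i j = s * X i j - u * Y i j by rewrite !mxE.
  rewrite entryE -amplitude_sqr// -/(kap t).
  have := tI _ _ _ wes wes i j.
  rewrite [X in Cintegral _ _ X](_ : _ = fun=> 1); last first.
    by apply/funext => w; rewrite subrr mulr0 !mul0r expi0.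
  rewrite Cintegral_cst; last exact: measurable_band.
  rewrite (_ : fine _ = B t); last exact: (congr1 fine (lebesgue_band _ (B0 t))).
  rewrite mul1r => /le_trans/(_ (small _ _ eps0 alM)) bound.
  set X := kirchhoff _ _ _ _ _ _ _ i j in bound *.
  have -> : (B t)^-1%:C%C * X - (kap t)%:C%C * leading_block (alpha t) i j =
      (B t)^-1%:C%C * (X - (kap t)%:C%C * leading_block (alpha t) i j * (B t)%:C%C).
    rewrite mulrBr; congr (_ - _).
    by rewrite mulrCA -rmorphM/= mulVf ?mulr1// gt_eqF.
  by rewrite Normc.normcM normc_real gtr0_norm ?invr_gt0// ler_pM2l ?invr_gt0.
Qed.
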